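(* There exist a Banach space $Z$ and a compact linear operator $S: Z\to Z$ which cannot be approximated by norm-attaining operators, i.e. $S$ does not belong to the operator-norm closure of $NA(Z,Z)$ in $L(Z,Z)$.
   Context: Banach spaces are real or complex. $L(Z,Z)$ is the Banach space of all bounded linear operators from $Z$ to $Z$ with the operator norm. An operator $T\in L(Z,Z)$ attains its norm if there is $z\in Z$ with $\|z\|=1$ and $\|T(z)\|=\|T\|$; $NA(Z,Z)$ denotes the set of all norm-attaining operators in $L(Z,Z)$. *)

(* Defs.v *)
From mathcomp Require Import all_boot all_order all_algebra.
From mathcomp Require Import all_classical all_reals all_analysis.
From mathcomp Require Export complex.

Set Implicit Arguments.
Unset Strict Implicit.
Unset Printing Implicit Defensive.

Import Order.TTheory GRing.Theory Num.Theory.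
Import numFieldNormedType.Exports.

Local Open Scope classical_set_scope.
Local Open Scope ring_scope.

(* The scalar field [K] is meant to be [R] or [R[i]] for
   [R : realType].  Norms take their values in [K]; in the partial order of
   [R[i]], [x <= y] forces [x] and [y] to have the same imaginary part, so
   suprema of sets of norms and conditions [0 < e] over [R[i]] are those of
   the reals. *)

Section Operators.
Context {K : numFieldType} {Z : normedModType K}.
Implicit Types T S : {linear Z -> Z}.

Definition bounded_operator T : Prop :=
  exists M : K, forall z : Z, `|T z| <= M * `|z|.

(* Meaningful for bounded linear maps only: [supremum] returns [0] on a set
   without supremum. *)
Definition opnorm (f : Z -> Z) : K :=
  supremum 0 [set `|f z| | z in [set z : Z | `|z| <= 1]].

Definition compact_operator T : Prop :=
  precompact (T @` [set z : Z | `|z| <= 1]).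

Definition NA : set {linear Z -> Z} :=
  [set T | bounded_operator T /\
           exists z : Z, `|z| = 1 /\ `|T z| = opnorm T].

(* Closure, for the operator norm, of a set [A] of bounded operators. *)
Definition opnorm_closure (A : set {linear Z -> Z}) : set {linear Z -> Z} :=
  [set S | bounded_operator S /\
           forall e : K, 0 < e -> exists T, A T /\ opnorm (S \- T) < e].

End Operators.

Arguments NA {K} Z.

(* Main.v *)
Require Import Defs.
From HB Require Import structures.
From mathcomp Require Import all_boot all_order all_algebra.
From mathcomp Require Import all_classical all_reals all_analysis.
From mathcomp Require Import lra ring zify.
Set Implicit Arguments.
Unset Strict Implicit.
Unset Printing Implicit Defensive.
Import Order.TTheory GRing.Theory Num.Theory.
Import numFieldNormedType.Exports.
Local Open Scope classical_set_scope.
Local Open Scope ring_scope.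
Local Open Scope complex_scope.


(** Let X be a closed subspace of c_0 and Y a strictly convex space, and give
    X + Y the maximum norm.  If an operator T into Y attains its norm at
    (x, y), then every v in X of norm at most 1/2 that is supported where x is
    at most 1/2 satisfies |(x + v, y)|, |(x - v, y)| <= 1.  Hence T(x, y) is the
    midpoint of T(x, y) + T v and T(x, y) - T v, none of which is longer, and
    strict convexity forces T v = 0 ([strict_convexity]).  So a norm-attaining
    operator into Y kills all the vectors of X that are supported far out, and
    a compact S : X -> Y such that no operator near S does this is not a limit
    of norm-attaining operators; (x, y) |-> (0, S x) carries the example to a
    single space.

    Such an S comes from Davie's construction of a space without the
    approximation property.  The coordinates are arranged in finite levels.
    Vectors e_j of generation k are supported on the levels k and k - 1, with
    the values 1 and -1 given by a column of the matrix [sigma k] on the first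
    and a column of [tau (k - 1)] on the second.  The columns are orthogonal,
    so that the coefficient of e_j in a combination can be read on either
    level.  The space X consists of the x in c_0 for which the two readings
    agree, and Y of the y for which they agree, with a weaker norm; S is the
    inclusion.  For V : X -> Y, let [trace k V] be the average over generation
    k of the coefficient of e_j in V e_j: it is 1 for S and 0 for large k if V
    kills the vectors supported far out.  When both traces are read on level k,
    [trace k.+1 V - trace k V] becomes the average over the points g of that
    level of the value at g of V applied to a vector [probe g] ([trace_step]).
    As the rows of the sign matrices are nearly orthogonal, [probe g] has norm
    O(k / 2^k) ([rnorm_probe]), while values on level k are at most (4/3)^k
    times the norm of Y.  The differences are therefore summable and the traces
    are bounded by 97 |V| ([trace_bound]): an operator that kills the vectors
    supported far out stays at distance at least 1/97 from S.

    The weight (3/4)^k that the norm of Y puts on level k tends to 0, and this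
    makes S compact ([unit_box_compact]).  The norm of Y is strictly convex
    because it is a supremum of Euclidean seminorms that share a growing
    quadratic part ([energy]).

    The sign matrices are Walsh matrices whose columns are multiplied by
    characters and signs.  Random choices make the rows nearly orthogonal; the
    choices are made one after the other so that a sum of exponential weights
    never exceeds its average ([balanced_choice]).

    The real and the complex case are the same proof over [scalars R K]. *)

(** * A greedy choice of signs *)

Lemma bernoulli_ge (F : realFieldType) (y : F) m :
  - 1 <= y -> 1 + m%:R * y <= (1 + y) ^+ m.
Proof.
move=> y1; elim: m => [|m IH]; first by rewrite mul0r addr0 expr0.
rewrite exprS; apply: le_trans (ler_wpM2l _ IH); last by lra.
have := sqr_ge0 y; have : (0 : F) <= m%:R by [].
rewrite -[m.+1]add1n natrD expr2; nra.
Qed.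

Lemma exists_le_average (C : finType) (f : C -> rat) (m : rat) :
  (0 < #|C|)%N -> \sum_c f c <= #|C|%:R * m -> exists c, f c <= m.
Proof.
move=> C0 fm; apply/existsP; apply: contraLR fm; rewrite negb_exists -ltNge.
move=> /forallP fm; rewrite mulr_natl -sumr_const; apply: ltr_sum.
  by apply/hasP; have [c _] := card_gt0P C0; exists c; rewrite ?mem_index_enum.
by move=> c _; rewrite ltNge.
Qed.

Section Balancing.
Context {I J C : finType}.
Variable a : I -> J -> C -> int.
Hypothesis C0 : (0 < #|C|)%N.
Hypothesis a1 : forall i j c, `|a i j c| = 1.
Hypothesis a0 : forall i j, \sum_c a i j c = 0.

Let weight (x : rat) (S : int) := x ^ S + x ^ (- S).
Let growth (x : rat) := (x + x^-1) / 2.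

Lemma sum_exprz (x : rat) (b : C -> int) S : 0 < x ->
  (forall c, `|b c| = 1) -> \sum_c b c = 0 ->
  \sum_c x ^ (S + b c) = #|C|%:R * growth x * x ^ S.
Proof.
move=> x0 b1 b0.
have E c : x ^ (S + b c) = growth x * x ^ S + x ^ S * ((x - x^-1) / 2) * (b c)%:~R.
  rewrite /growth expfzDr ?gt_eqF //.
  have [->|->] : b c = 1 \/ b c = -1 by have := b1 c; lia.
    by rewrite expr1z; field; rewrite gt_eqF.
  by rewrite exprN1 mulrN1z; field; rewrite gt_eqF.
rewrite (eq_bigr _ (fun c _ => E c)) big_split /= sumr_const -big_distrr /=.
have -> : \sum_c (b c)%:~R = 0 :> rat by rewrite -(rmorph_sum intr) b0.
by rewrite mulr0 addr0 -[LHS]mulr_natl mulrA.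
Qed.

Lemma sum_weight x i j S : 0 < x ->
  \sum_c weight x (S + a i j c) = #|C|%:R * growth x * weight x S.
Proof.
move=> x0; rewrite big_split /= sum_exprz //.
under [X in _ + X]eq_bigr do rewrite opprD.
by rewrite sum_exprz ?mulrDr // => [c|]; rewrite ?normrN // sumrN a0 oppr0.
Qed.

(** Choosing the value at one more index multiplies each weight by [growth x] on
    average ([sum_weight]), so some value multiplies their sum by no more than
    that. *)
Lemma greedy_choice x (s : seq J) : 0 < x -> uniq s ->
  exists c : J -> C, \sum_i weight x (\sum_(j <- s) a i j (c j))
    <= #|I|%:R * 2 * growth x ^+ size s.
Proof.
move=> x0; have [c1 _] := card_gt0P C0.
elim: s => [_|j s IH /= /andP[js us]].
  exists (fun=> c1); rewrite expr0 mulr1 le_eqVlt; apply/orP; left; apply/eqP.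
  under eq_bigr do rewrite big_nil /weight oppr0 expr0z.
  by rewrite sumr_const mulr_natl.
have [c cP] := IH us.
have [d dP] : exists d, \sum_i weight x (\sum_(k <- s) a i k (c k) + a i j d)
    <= #|I|%:R * 2 * growth x ^+ (size s).+1.
  apply: exists_le_average => //; rewrite exchange_big /=.
  under eq_bigr do rewrite sum_weight //.
  rewrite -big_distrr /= -mulrA; apply: ler_wpM2l => //.
  rewrite exprS mulrCA; apply: ler_wpM2l => //.
  by rewrite /growth; have := @invr_ge0 rat x; lra.
exists (fun k => if k == j then d else c k); apply: le_trans dP.
rewrite le_eqVlt; apply/orP; left; apply/eqP; apply: eq_bigr => i _.
rewrite big_cons eqxx addrC; congr (weight x (_ + _)).
by apply: eq_big_seq => k ks; case: eqP => // kj; rewrite -kj ks in js.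
Qed.

(** A Chernoff bound without probabilities.  With x = 1 + 1/t the total weight
    stays below 4 #|I| after t^2 steps, as [growth x] is at most 1 + 1/(2 t^2),
    whereas a single sum exceeding t (M + 2) already has weight more than
    2^(M + 2), as x^t is at least 2. *)
Lemma balanced_choice t M : (0 < t)%N -> (#|J| <= t ^ 2)%N -> (#|I| <= 2 ^ M)%N ->
  exists c : J -> C, forall i, `|\sum_j a i j (c j)| <= (t * (M + 2))%:Z.
Proof.
move=> t0 Jt IM; pose x : rat := 1 + t%:R^-1.
have t0' : (0 : rat) < t%:R by rewrite ltr0n.
have x1 : 1 < x by rewrite ltrDl invr_gt0.
have x0 : 0 < x by apply: lt_trans x1.
have [c cP] := greedy_choice x0 (index_enum_uniq J).
exists c => i; rewrite leNgt; apply/negP => big.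
pose S := \sum_j a i j (c j).
have xt : 2 <= x ^+ t.
  apply: le_trans (bernoulli_ge t (_ : -1 <= t%:R^-1)).
    by rewrite divff ?gt_eqF.
  by apply: (@le_trans _ _ 0) => //; rewrite invr_ge0 ltW.
have lo : 2 ^+ (M + 2) < x ^+ `|S|%N.
  apply: (@le_lt_trans _ _ (x ^+ (t * (M + 2)))).
    by rewrite exprM lerXn2r // nnegrE ?exprn_ge0 // ltW.
  by rewrite ltr_eXn2l //; move: big; rewrite -/S -abszE ltz_nat.
have loS : x ^+ `|S|%N <= weight x S.
  rewrite /weight; have := exprz_ge0 S (ltW x0).
  have := exprz_ge0 (- S) (ltW x0).
  have [->|->] : x ^+ `|S|%N = x ^ S \/ x ^+ `|S|%N = x ^ (- S); try lra.
  have [S0|/ltW S0] := leP 0 S; [left|right].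
    by rewrite exprnP gez0_abs.
  by rewrite exprnP lez0_abs.
have one : weight x S <= \sum_i weight x (\sum_j a i j (c j)).
  rewrite [leRHS](bigD1 i) //= lerDl; apply: sumr_ge0 => k _.
  by rewrite addr_ge0 // exprz_ge0 // ltW.
pose y : rat := (2 * t%:R ^+ 2)^-1.
have y0 : 0 < y by rewrite invr_gt0 mulr_gt0 ?exprn_gt0.
have y2 : y <= 1 / 2.
  have t1 : 1 <= t%:R ^+ 2 :> rat by rewrite exprn_ege1 // ler1n.
  by rewrite /y mul1r lef_pV2 ?posrE ?mulr_gt0 ?exprn_gt0 //; lra.
have gy : growth x <= 1 + y.
  have -> : growth x = 1 + (2 * t%:R * (t%:R + 1))^-1.
    by rewrite /growth /x; field; rewrite !gt_eqF //= -?(natrD _ t 1) ?ltr0n ?addn1 //; lra.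
  have t2 : 0 < 2 * t%:R ^+ 2 :> rat by rewrite mulr_gt0 ?exprn_gt0.
  have tt : 2 * t%:R ^+ 2 <= 2 * t%:R * (t%:R + 1) :> rat by rewrite expr2; nra.
  by rewrite lerD2l lef_pV2 // posrE; apply: lt_le_trans tt.
have g1 : 1 <= 1 + y by lra.
have size_le : growth x ^+ size (index_enum J) <= (1 + y) ^+ (t ^ 2).
  apply: (@le_trans _ _ ((1 + y) ^+ size (index_enum J))).
    rewrite lerXn2r // ?nnegrE; last by lra.
    by rewrite /growth; have := @invr_ge0 rat x; lra.
  by rewrite ler_weXn2l // -[index_enum J]enumT -cardE.
have g2 : (1 + y) ^+ (t ^ 2) <= 2.
  have := bernoulli_ge (t ^ 2) (_ : -1 <= - y); rewrite natrX.
  have -> : 1 + t%:R ^+ 2 * - y = 1 / 2 by rewrite /y; field; rewrite gt_eqF.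
  move=> H; have {}H := H ltac:(lra).
  have P : (1 + y) ^+ (t ^ 2) * (1 - y) ^+ (t ^ 2) <= 1.
    by rewrite -exprMn exprn_ile1 //; nra.
  have : 0 <= (1 + y) ^+ (t ^ 2) by apply: exprn_ge0; lra.
  nra.
have IM' : #|I|%:R <= 2 ^+ M :> rat by rewrite -natrX ler_nat.
have : #|I|%:R * 2 * growth x ^+ size (index_enum J) <= 2 ^+ M * 2 * 2.
  apply: ler_pM => //; rewrite ?mulr_ge0 ?ler_wpM2r //.
    by apply: exprn_ge0; rewrite /growth; have := @invr_ge0 rat x; lra.
  exact: le_trans g2.
move: lo; rewrite exprD expr2; lra.
Qed.

End Balancing.

(** * Sign matrices with nearly orthogonal rows *)

Record hadamard (T : finType) (h : T -> T -> int) : Prop := Hadamard {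
  hadamard_sign : forall x y, `|h x y| = 1;
  hadamard_col : forall i j, \sum_x h x i * h x j = #|T|%:Z *+ (i == j);
  hadamard_row : forall x y, \sum_j h x j * h y j = #|T|%:Z *+ (x == y) }.

Definition kron (S T : finType) (g : S -> S -> int) (h : T -> T -> int) :=
  fun x y : S * T => g x.1 y.1 * h x.2 y.2.

Lemma sum_prodE (S T : finType) (f : S -> int) (g : T -> int) :
  \sum_(x : S * T) f x.1 * g x.2 = (\sum_x f x) * (\sum_y g y).
Proof.
rewrite big_distrlr /= pair_bigA /=.
by apply: eq_bigr.
Qed.

Lemma kron_hadamard (S T : finType) (g : S -> S -> int) (h : T -> T -> int) :
  hadamard g -> hadamard h -> hadamard (kron g h).
Proof.
move=> [g1 gc gr] [h1 hc hr]; split=> [x y|[i1 i2] [j1 j2]|[i1 i2] [j1 j2]].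
- by rewrite normrM g1 h1.
- under eq_bigr do rewrite /kron mulrACA.
  rewrite (sum_prodE (fun x => g x i1 * g x j1) (fun x => h x i2 * h x j2)) gc hc.
  by rewrite card_prod PoszM mulrnAl mulrnAr -mulrnA mulnb xpair_eqE andbC.
- under eq_bigr do rewrite /kron mulrACA.
  rewrite (sum_prodE (fun x => g i1 x * g j1 x) (fun x => h i2 x * h j2 x)) gr hr.
  by rewrite card_prod PoszM mulrnAl mulrnAr -mulrnA mulnb xpair_eqE andbC.
Qed.

Lemma sign_sqr (x : int) : `|x| = 1 -> x * x = 1.
Proof. by move=> x1; have [->|->] : x = 1 \/ x = -1 by lia. Qed.

Definition hbool (x y : bool) : int := (-1) ^+ (x && y).

Lemma hbool_hadamard : hadamard hbool.
Proof.
split=> [x y|i j|i j]; first by rewrite normr_sign.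
  by rewrite big_bool card_bool; case: i j => [] [].
by rewrite big_bool card_bool; case: i j => [] [].
Qed.

Definition quad : finType := (bool * bool)%type.
(** Five of the eight elements of [octo] are used as column labels: one for a
    column of [sigma] and four for columns of [tau].  This is what lets the
    generations grow by a factor 4. *)
Definition octo : finType := (bool * quad)%type.
Definition hquad : quad -> quad -> int := kron hbool hbool.
Definition hocto : octo -> octo -> int := kron hbool hquad.

Lemma hquad_hadamard : hadamard hquad.
Proof. exact: kron_hadamard hbool_hadamard hbool_hadamard. Qed.

Lemma hocto_hadamard : hadamard hocto.
Proof. exact: kron_hadamard hbool_hadamard hquad_hadamard. Qed.

Fixpoint walsh_index (k : nat) : finType :=
  if k is m.+1 then (walsh_index m * quad)%type else unit.

Fixpoint walsh (k : nat) : walsh_index k -> walsh_index k -> int :=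
  if k is m.+1 then kron (@walsh m) hquad else fun _ _ => 1.

Lemma card_walsh_index k : #|walsh_index k| = (4 ^ k)%N.
Proof.
elim: k => [|k IH]; first by rewrite card_unit.
by rewrite card_prod IH card_prod card_bool expnS mulnC.
Qed.

Lemma card_octo : #|octo| = 8%N.
Proof. by rewrite !card_prod !card_bool. Qed.

Lemma walsh_hadamard k : hadamard (@walsh k).
Proof.
elim: k => [|k IH]; last exact: kron_hadamard IH hquad_hadamard.
split=> [//|[] []|[] []]; by rewrite big_const card_unit.
Qed.

Section TwistedColumns.
Variables (T V : finType) (h : T -> T -> int) (u : V -> V -> int).
Hypotheses (hh : hadamard h) (uh : hadamard u).
Variable r : T -> V.

(** The Kronecker product of [h] and [u], with the block of columns labelled by
    [i] multiplied by column [r i] of [u].  As this multiplication does not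
    change products of two columns of the same block, the columns remain
    orthogonal for every [r]; a good [r] makes parts of rows nearly
    orthogonal. *)
Definition twist (g p : T * V) : int :=
  h g.1 p.1 * u g.2 (r p.1) * u g.2 p.2.

Lemma twist_sign g p : `|twist g p| = 1.
Proof. by rewrite !normrM !(hadamard_sign hh, hadamard_sign uh). Qed.

Lemma twist_col p q : \sum_g twist g p * twist g q = #|{: T * V}|%:Z *+ (p == q).
Proof.
case: p q => [i p] [j q].
pose f x := h x i * h x j.
pose e v := u v (r i) * u v p * (u v (r j) * u v q).
rewrite (eq_bigr (fun g => f g.1 * e g.2)); last first.
  by move=> g _; rewrite /twist /f /e /=; ring.
rewrite sum_prodE (hadamard_col hh) xpair_eqE /e.
have [<-|_] := eqVneq i j; last by rewrite mul0r.
under [X in _ * X]eq_bigr => v _.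
  rewrite mulrACA sign_sqr ?mul1r; last exact: hadamard_sign uh _ _.
  over.
by rewrite (hadamard_col uh) mulr1n mulrnAr -PoszM card_prod.
Qed.

End TwistedColumns.

Definition balance (k : nat) : nat := (2 ^ k * (4 * k + 8))%N.

(** For v different from w, the rows v and w of [u] are orthogonal, so that
    the products of their entries at a column that varies average to 0 and
    the sums can be balanced. *)
Lemma exists_twist (u : octo -> octo -> int) (uh : hadamard u) k :
  exists r : walsh_index k -> octo, forall x y v w, v != w ->
  `|\sum_j walsh x j * walsh y j * (u v (r j) * u w (r j))| <= (balance k)%:Z.
Proof.
pose a (i : walsh_index k * walsh_index k * (octo * octo)) (j : walsh_index k) (c : octo) : int :=
  (* When the two rows coincide, any two distinct rows will do: nothing is
     claimed for that index. *)
  let vw := if i.2.1 != i.2.2 then i.2 else ((true, (true, true)), (false, (false, false))) in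
  walsh i.1.1 j * walsh i.1.2 j * (u vw.1 c * u vw.2 c).
have Wh := walsh_hadamard k.
have [||||||r rP] := @balanced_choice _ _ _ a _ _ _ (2 ^ k) (4 * k + 6).
- by rewrite card_octo.
- by move=> i j c; rewrite !normrM !(hadamard_sign Wh, hadamard_sign uh) !mulr1.
- move=> i j; rewrite -big_distrr /= (hadamard_row uh).
  by case: (i.2.1 =P i.2.2) => [_|/eqP/negbTE->] /=; rewrite mulr0.
- by rewrite expn_gt0.
- by rewrite card_walsh_index -expnM mulnC (expnM 2 2).
- rewrite !(card_octo, card_walsh_index, card_prod) -[8%N]/(2 ^ 3)%N.
  rewrite -[4%N]/(2 ^ 2)%N -!expnM -!expnD.
  by rewrite leq_exp2l //; lia.
exists r => x y v w vw; apply: le_trans (le_trans (rP ((x, y), (v, w))) _).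
  by rewrite /a /= vw.
by rewrite /balance -addnA.
Qed.

(** The combinatorial data.  The vectors of generation k are indexed by
    [mode k]; on the points of level k, column i of [sigma k] gives the values
    of vector i of generation k and column i of [tau k] those of vector i of
    generation k + 1.  Rows have length 4^k for [sigma] and 4^(k + 1) for [tau],
    so that the row conditions bound the normalized products of distinct rows
    by O(k / 2^k). *)
Record tower := Tower {
  mode : nat -> finType;
  point : nat -> finType;
  sigma : forall k, point k -> mode k -> int;
  tau : forall k, point k -> mode k.+1 -> int;
  card_mode : forall k, #|mode k| = (4 ^ k)%N;
  card_point : forall k, #|point k| = (8 * 4 ^ k)%N;
  sigma_sign : forall k g i, `|@sigma k g i| = 1;
  tau_sign : forall k g i, `|@tau k g i| = 1;
  sigma_orth : forall k i j,
    \sum_g @sigma k g i * @sigma k g j = #|point k|%:Z *+ (i == j);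
  tau_orth : forall k i j,
    \sum_g @tau k g i * @tau k g j = #|point k|%:Z *+ (i == j);
  sigma_tau_orth : forall k i j, \sum_g @sigma k g i * @tau k g j = 0;
  sigma_row : forall k g h, g != h ->
    `|\sum_i @sigma k g i * @sigma k h i| <= (balance k)%:Z;
  tau_row : forall k g h, g != h ->
    `|\sum_i @tau k g i * @tau k h i| <= (4 * balance k)%:Z;
  tau_sigma_row : forall k g h,
    `|\sum_i @tau k g i * @sigma k.+1 h i| <= (balance k.+1)%:Z }.

(** With N = 4^k, the points of level k label the rows and columns of a
    twisted Hadamard matrix of order 8 N; N of its columns make [sigma k] and
    4 N make [tau k].  The product of rows (x, v) and (y, w) is controlled by
    the orthogonality of Walsh rows if v = w, and by the twist otherwise.  The
    columns of [sigma] are further multiplied by signs [eps], which preserve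
    these conditions, to make the rows of [sigma] nearly
    orthogonal to those of [tau] one level below. *)
Lemma exists_tower : inhabited tower.
Proof.
have [u uh] : exists u : octo -> octo -> int, hadamard u.
  by exists hocto; exact: hocto_hadamard.
pose r k := sval (cid (exists_twist uh k)).
have rP k := svalP (cid (exists_twist uh k)).
pose G k : finType := (walsh_index k * octo)%type.
pose col k := twist (@walsh k) u (r k).
pose up k (i : walsh_index k.+1) : G k := (i.1, (true, i.2)).
pose lo k (i : walsh_index k) : G k := (i, (false, (false, false))).
have Wh := walsh_hadamard.
have col1 k g p : `|col k g p| = 1 by exact: twist_sign.
have exeps k : exists e : walsh_index k -> int, (forall i, `|e i| = 1) /\
    forall l (E : k = l.+1) (g : G l) (h : G k),
    `|\sum_i col l g (up l (ecast k (walsh_index k) E i)) * (e i * col k h (lo k i))|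
      <= (balance k)%:Z.
  case: k => [|k]; first by exists (fun=> 1); split => // l E.
  pose a (gh : G k * G k.+1) (i : walsh_index k.+1) (b : bool) : int :=
    col k gh.1 (up k i) * ((-1) ^+ b * col k.+1 gh.2 (lo k.+1 i)).
  have [||||||e eP] := @balanced_choice _ _ _ a _ _ _ (2 ^ k.+1) (4 * k.+1 + 6).
  - by rewrite card_bool.
  - by move=> i j c; rewrite /a (normrM (col _ _ _)) (normrM ((-1) ^+ c)) normr_sign !col1.
  - by move=> i j; rewrite big_bool /a /=; ring.
  - by rewrite expn_gt0.
  - by rewrite card_walsh_index -expnM mulnC (expnM 2 2).
  - rewrite !(card_octo, card_walsh_index, card_prod) -[8%N]/(2 ^ 3)%N.
    rewrite -[4%N]/(2 ^ 2)%N -!expnM -!expnD.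
    by rewrite leq_exp2l //; lia.
  exists (fun i => (-1) ^+ (e i)); split => [i|l E g h]; first by rewrite normr_sign.
  have El : k = l by case: E.
  subst l; rewrite (eq_irrelevance E erefl) /=.
  by apply: le_trans (eP (g, h)) _; rewrite /balance -addnA.
pose eps k := sval (cid (exeps k)).
have epsP k := svalP (cid (exeps k)).

have colo k p q : \sum_g col k g p * col k g q = #|G k|%:Z *+ (p == q).
  exact: twist_col.
have eps1 k i : `|eps k i| = 1 by exact: (epsP k).1.
have row k (x y : walsh_index k) v w : (x, v) != (y, w) ->
    `|\sum_j walsh x j * walsh y j * (u v (r k j) * u w (r k j))|
      <= (balance k)%:Z *+ (v != w).
  have [<-|vw _] := eqVneq v w; last exact: rP.
  rewrite xpair_eqE eqxx andbT => /negbTE xy.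
  under eq_bigr do rewrite (@sign_sqr (u _ _)) ?mulr1 ?(hadamard_sign uh) //.
  by rewrite (hadamard_row (Wh k)) xy normr0.
apply: inhabits; apply: (@Tower walsh_index G
  (fun k g i => eps k i * col k g (lo k i)) (fun k g i => col k g (up k i))).
- exact: card_walsh_index.
- by move=> k; rewrite card_prod card_walsh_index card_octo mulnC.
- by move=> k g i; rewrite normrM eps1 col1 mulr1.
- by move=> k g i; exact: col1.
- move=> k i j.
  rewrite (eq_bigr (fun g => eps k i * eps k j * (col k g (lo k i) * col k g (lo k j)))).
    rewrite -big_distrr /= colo xpair_eqE eqxx andbT.
    by have [<-|] := eqVneq i j; rewrite ?mulr0 // sign_sqr ?mul1r.
  by move=> g _; ring.
- by move=> k [i c] [j d]; rewrite colo /up /= !xpair_eqE.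
- move=> k i j; rewrite (eq_bigr (fun g => eps k i * (col k g (lo k i) * col k g (up k j)))).
    by rewrite -big_distrr /= colo xpair_eqE andbF mulr0.
  by move=> g _; ring.
- move=> k [x v] [y w] gh.
  rewrite (eq_bigr (fun j => u v (false, (false, false)) * u w (false, (false, false)) *
     (walsh x j * walsh y j * (u v (r k j) * u w (r k j))))); last first.
    move=> j _; rewrite /col /twist /=.
    transitivity ((eps k j * eps k j) * (u v (false, (false, false)) * u w (false, (false, false)) *
     (walsh x j * walsh y j * (u v (r k j) * u w (r k j))))); first by ring.
    by rewrite sign_sqr ?mul1r.
  rewrite -big_distrr /= !normrM !(hadamard_sign uh) !mul1r.
  by apply: le_trans (row _ _ _ _ _ gh) _; case: (v != w).
- move=> k [x v] [y w] gh.
  pose f j := walsh x j * walsh y j * (u v (r k j) * u w (r k j)).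
  pose e d := u v (true, d) * u w (true, d).
  rewrite (eq_bigr (fun i => f i.1 * e i.2)); last first.
    by move=> i _; rewrite /col /twist /f /e /=; ring.
  rewrite sum_prodE normrM mulnC PoszM; apply: ler_pM => //.
    by apply: le_trans (row _ _ _ _ _ gh) _; case: (v != w).
  apply: le_trans (ler_norm_sum _ _ _) _.
  under eq_bigr do rewrite normrM !(hadamard_sign uh) mulr1.
  by rewrite sumr_const card_prod card_bool.
- by move=> k g h; have [_ /(_ k erefl g h)] := epsP k.+1.
Qed.

(** * Real and complex scalars *)

(** The field [K] is [R] or [R[i]].  Its norm takes values in [K], whereas
    suprema are available in [R] only: [abs] is the norm with values in [R] and
    [emb] brings it back.  The local compactness of [K] is expressed by
    ultrafilters, which serve both for completeness and for compactness. *)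
Record scalars (R : realType) (K : numFieldType) := Scalars {
  emb : {rmorphism R -> K};
  abs : K -> R;
  emb_le : forall a b, (emb a <= emb b) = (a <= b);
  absE : forall x, `|x| = emb (abs x);
  abs_parallelogram : forall x y,
    abs (x + y) ^+ 2 + abs (x - y) ^+ 2 = 2 * (abs x ^+ 2 + abs y ^+ 2);
  ultra_limit : forall (T : Type) (F : set_system T) (u : T -> K) (M : R),
    UltraFilter F -> F [set t | abs (u t) <= M] ->
    exists l, forall e, 0 < e -> F [set t | abs (u t - l) <= e] }.

Lemma ultra_limit_real (R : realType) (T : Type) (F : set_system T)
    (u : T -> R) (M : R) : UltraFilter F -> F [set t | `|u t| <= M] ->
  exists l, forall e, 0 < e -> F [set t | `|u t - l| <= e].
Proof.
move=> UF FM; have PF := @ultra_proper _ _ UF.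
have FMM : F (u @^-1` [set` `[- M, M]]).
  by apply: filterS FM => t /=; rewrite in_itv /= ler_norml.
have [l [_ ul]] := @segment_compact R (- M) M (u @ F) _ FMM.
exists l => e e0; have [//|far] := in_ultra_setVsetC [set t | `|u t - l| <= e] UF.
have [y [/= uy ly]] := ul (~` [set x | `|x - l| <= e]) _ far (nbhsx_ballx l e e0).
by case: uy; rewrite distrC; apply: ltW.
Qed.

Program Definition real_scalars (R : realType) : scalars R R :=
  @Scalars R R idfun Num.norm _ _ _ _.
Next Obligation. by []. Qed.
Next Obligation. by []. Qed.
Next Obligation. by move=> R x y; rewrite !real_normK ?num_real //; ring. Qed.
Next Obligation. exact: ultra_limit_real. Qed.

Section Complex.
Variable R : realType.

Lemma normc_le (x : R[i]) : ComplexField.Normc.normc x <= `|complex.Re x| + `|complex.Im x|.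
Proof.
case: x => a b /=; rewrite -[leRHS]ger0_norm ?addr_ge0 // -sqrtr_sqr ler_sqrt ?sqr_ge0 //.
rewrite sqrrD !real_normK ?num_real //.
by have := normr_ge0 a; have := normr_ge0 b; nra.
Qed.

Lemma ultra_limit_complex (T : Type) (F : set_system T)
    (u : T -> R[i]) (M : R) : UltraFilter F ->
  F [set t | ComplexField.Normc.normc (u t) <= M] ->
  exists l, forall e, 0 < e -> F [set t | ComplexField.Normc.normc (u t - l) <= e].
Proof.
move=> UF FM; have PF := @ultra_proper _ _ UF.
have ReM : F [set t | `|complex.Re (u t)| <= M].
  apply: filterS FM => t /=; case: (u t) => a b /= H.
  apply: le_trans H; rewrite -sqrtr_sqr ler_sqrt ?addr_ge0 ?sqr_ge0 //.
  by rewrite lerDl sqr_ge0.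
have ImM : F [set t | `|complex.Im (u t)| <= M].
  apply: filterS FM => t /=; case: (u t) => a b /= H.
  apply: le_trans H; rewrite -sqrtr_sqr ler_sqrt ?addr_ge0 ?sqr_ge0 //.
  by rewrite lerDr sqr_ge0.
have [a aP] := ultra_limit_real UF ReM; have [b bP] := ultra_limit_real UF ImM.
exists (a +i* b) => e e0; have e2 : 0 < e / 2 by lra.
apply: filterS (filterI (aP _ e2) (bP _ e2)) => t /=; case: (u t) => c d /= [ca db].
apply: (le_trans (normc_le ((c +i* d) - (a +i* b)))) => /=; lra.
Qed.

Program Definition complex_scalars : scalars R R[i] :=
  @Scalars R R[i] (real_complex R) (@ComplexField.Normc.normc R) _ _ _ _.
Next Obligation. by move=> a b; rewrite lecR. Qed.
Next Obligation. by []. Qed.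
Next Obligation.
move=> [a b] [c d] /=; rewrite !sqr_sqrtr ?addr_ge0 ?sqr_ge0 //.
by ring.
Qed.
Next Obligation. exact: ultra_limit_complex. Qed.
End Complex.

(** * The Banach space *)

Section ScalarTheory.
Context (R : realType) (K : numFieldType) (s : scalars R K).
Local Notation emb := (emb s).
Local Notation abs := (abs s).

Lemma emb_inj : injective emb.
Proof. by move=> a b ab; apply/eqP; rewrite eq_le -!(emb_le s) ab lexx. Qed.

Lemma emb_lt a b : (emb a < emb b) = (a < b).
Proof. by rewrite !lt_neqAle emb_le (inj_eq emb_inj). Qed.

Lemma emb_ge0 a : (0 <= emb a) = (0 <= a).
Proof. by rewrite -[0 in LHS](rmorph0 emb) emb_le. Qed.

Lemma abs_ge0 x : 0 <= abs x.
Proof. by rewrite -emb_ge0 -absE. Qed.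

Lemma abs_emb a : 0 <= a -> abs (emb a) = a.
Proof. by move=> a0; apply: emb_inj; rewrite -absE ger0_norm ?emb_ge0. Qed.

Lemma emb_abs x : 0 <= x -> emb (abs x) = x.
Proof. by move=> x0; rewrite -absE ger0_norm. Qed.

Lemma abs0 : abs 0 = 0.
Proof. by apply: emb_inj; rewrite -absE normr0 rmorph0. Qed.

Lemma abs0_eq0 x : abs x = 0 -> x = 0.
Proof. by move=> x0; apply: normr0_eq0; rewrite (absE s) x0 rmorph0. Qed.

Lemma absN x : abs (- x) = abs x.
Proof. by apply: emb_inj; rewrite -!absE normrN. Qed.

Lemma absM x y : abs (x * y) = abs x * abs y.
Proof. by apply: emb_inj; rewrite rmorphM -!absE normrM. Qed.

Lemma absD x y : abs (x + y) <= abs x + abs y.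
Proof. by rewrite -(emb_le s) rmorphD -!absE ler_normD. Qed.

Lemma absB x y : abs (x - y) <= abs x + abs y.
Proof. by rewrite -[abs y]absN absD. Qed.

Lemma abs_subC x y : abs (x - y) = abs (y - x).
Proof. by rewrite -absN opprB. Qed.

Lemma abs_int (m : int) : abs m%:~R = `|m|%:~R.
Proof. by apply: emb_inj; rewrite -absE rmorph_int intr_norm. Qed.

Lemma abs_natV n : abs n%:R^-1 = n%:R^-1.
Proof. by apply: emb_inj; rewrite -absE fmorphV rmorph_nat ger0_norm ?invr_ge0. Qed.

Lemma abs_sum (I : Type) (r : seq I) (P : pred I) (f : I -> K) :
  abs (\sum_(i <- r | P i) f i) <= \sum_(i <- r | P i) abs (f i).
Proof.
elim/big_rec2: _ => [|i a b _ IH]; first by rewrite abs0.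
by apply: le_trans (absD _ _) _; rewrite lerD2l.
Qed.

(** An average with signs is bounded by the terms; this gives the continuity of
    coefficients and bounds the traces. *)
Lemma abs_sum_sign (T : finType) (c : T -> int) (f : T -> K) e :
  0 <= e -> (forall i, `|c i| = 1) -> (forall i, abs (f i) <= e) ->
  abs (#|T|%:R^-1 * \sum_i (c i)%:~R * f i) <= e.
Proof.
move=> e0 c1 fe; have [T0|T0] := posnP #|T|.
  by rewrite T0 invr0 mul0r abs0.
rewrite absM abs_natV ler_pdivrMl ?ltr0n //.
apply: le_trans (abs_sum _ _ _) _; rewrite mulr_natl -sumr_const.
by apply: ler_sum => i _; rewrite absM abs_int c1 mul1r.
Qed.

End ScalarTheory.

Section Hilbertian.
Context (R : realType) (K : numFieldType) (s : scalars R K) (A : Type).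
Local Notation abs := (abs s).
Implicit Types (y z : A -> K) (Q : (A -> K) -> R).

(** The square of a Euclidean seminorm.  The parallelogram identity serves for
    strict convexity, the triangle inequality for the norm, and both survive
    the addition of squares. *)
Record hilbertian Q : Prop := Hilbertian {
  hilb_ge0 : forall y, 0 <= Q y;
  hilbZ : forall c y, Q (c *: y) = abs c ^+ 2 * Q y;
  hilb_parallelogram : forall y z, Q (y + z) + Q (y - z) = 2 * (Q y + Q z);
  hilbD : forall y z, Num.sqrt (Q (y + z)) <= Num.sqrt (Q y) + Num.sqrt (Q z) }.

Lemma hilb_coord a : hilbertian (fun y => abs (y a) ^+ 2).
Proof.
split=> [y|c y|y z|y z]; first exact: sqr_ge0.
- by rewrite -exprMn -absM.
- exact: abs_parallelogram.
- by rewrite !sqrtr_sqr !ger0_norm ?abs_ge0 ?absD.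
Qed.

Lemma hilbertianZ c Q : 0 <= c -> hilbertian Q -> hilbertian (fun y => c * Q y).
Proof.
move=> c0 [Q0 QZ QP QD]; split=> [y|d y|y z|y z].
- exact: mulr_ge0.
- by rewrite QZ mulrCA.
- by rewrite -!mulrDr QP mulrCA.
- by rewrite !sqrtrM // -mulrDr; apply: ler_wpM2l; rewrite ?sqrtr_ge0 ?QD.
Qed.

Lemma hilbertianD Q1 Q2 : hilbertian Q1 -> hilbertian Q2 ->
  hilbertian (fun y => Q1 y + Q2 y).
Proof.
move=> [Q0 QZ QP QD] [P0 PZ PP PD]; split=> [y|c y|y z|y z].
- exact: addr_ge0.
- by rewrite QZ PZ mulrDr.
- by rewrite addrACA QP PP; ring.
(* Minkowski's inequality in the plane is the triangle inequality for complex
   numbers. *)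
- have := @le_normcD R (Complex (Num.sqrt (Q1 y)) (Num.sqrt (Q2 y)))
    (Complex (Num.sqrt (Q1 z)) (Num.sqrt (Q2 z))).
  rewrite /= !sqr_sqrtr //; apply: le_trans.
  rewrite ler_sqrt ?addr_ge0 ?sqr_ge0 //; apply: lerD.
    by rewrite -{1}[Q1 _]sqr_sqrtr // lerXn2r ?nnegrE ?addr_ge0 ?sqrtr_ge0.
  by rewrite -{1}[Q2 _]sqr_sqrtr // lerXn2r ?nnegrE ?addr_ge0 ?sqrtr_ge0.
Qed.

Lemma hilbertian_sum (I : Type) (r : seq I) (Q : I -> (A -> K) -> R) :
  (forall i, hilbertian (Q i)) -> hilbertian (fun y => \sum_(i <- r) Q i y).
Proof.
move=> QH; elim: r => [|i r IH].
  have -> : (fun y => \sum_(i <- [::]) Q i y) = fun=> 0 :> R.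
    by apply/funext => y; rewrite big_nil.
  by split=> *; rewrite ?sqrtr0; lra.
have -> : (fun y => \sum_(j <- i :: r) Q j y) =
    fun y => Q i y + \sum_(j <- r) Q j y.
  by apply/funext => y; rewrite big_cons.
exact: hilbertianD.
Qed.

End Hilbertian.

Section Space.
Context (R : realType) (K : numFieldType) (s : scalars R K) (B : tower).
Local Notation emb := (emb s).
Local Notation abs := (abs s).
Local Notation site := {k : nat & point B k}.
Local Notation at_ g := (Tagged (point B) g).
Implicit Types (x y z : site -> K) (w : (site -> K) * (site -> K)).

(** Truncating the quadratic part at a finite level keeps every seminorm
    dependent on finitely many coordinates, so that each of them is continuous
    for pointwise convergence; the supremum over [n] is taken with the
    supremum over the points. *)
Definition mass n y : R := \sum_(l < n)
  2^-1 ^+ l * (#|point B l|%:R^-1 * \sum_(g : point B l) abs (y (at_ g)) ^+ 2).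

(** The supremum of the square roots of [energy i] is the norm of the second
    component.  The first term makes it at least (3/4)^k times the values on
    level k; the second one makes it strictly convex. *)
Definition energy (i : site * nat) y : R :=
  (3 / 4) ^+ (2 * tag i.1) * abs (y i.1) ^+ 2 + mass i.2 y.

Lemma energy_hilb i : hilbertian s (energy i).
Proof.
apply: hilbertianD.
  by apply: hilbertianZ (hilb_coord s _); apply: exprn_ge0; lra.
apply: hilbertian_sum => l; apply: hilbertianZ; first by apply: exprn_ge0; lra.
apply: hilbertianZ; first by rewrite invr_ge0.
by apply: hilbertian_sum => g; exact: hilb_coord.
Qed.

Lemma mass_hilb n : hilbertian s (mass n).
Proof.
apply: hilbertian_sum => l; apply: hilbertianZ; first by apply: exprn_ge0; lra.
apply: hilbertianZ; first by rewrite invr_ge0.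
by apply: hilbertian_sum => g; exact: hilb_coord.
Qed.

(** The norm of (x, y) is the supremum of these seminorms.  The zero seminorm
    only makes the family nonempty. *)
Definition semi (i : option (site + site * nat)) w : R :=
  match i with
  | None => 0
  | Some (inl a) => abs (w.1 a)
  | Some (inr b) => Num.sqrt (energy b w.2)
  end.

(** The coefficient on vector i of generation k + 1 is the same whether it is
    read on level k + 1 or on level k. *)
Definition balanced x : Prop := forall k (i : mode B k.+1),
  #|point B k.+1|%:R^-1 * \sum_g (sigma g i)%:~R * x (at_ g) =
  #|point B k|%:R^-1 * \sum_g (tau g i)%:~R * x (at_ g).

Definition vanishing x : Prop := forall e : R, 0 < e ->
  exists n, forall a : site, (n <= tag a)%N -> abs (x a) <= e.

(** The first component lies in c_0, so that its tails are small and leave room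
    for perturbations inside the unit ball. *)
Definition member w : Prop :=
  [/\ exists M, forall i, semi i w <= M, vanishing w.1,
      balanced w.1 & balanced w.2].

Lemma semi_ge0 i w : 0 <= semi i w.
Proof. by case: i => [[a|b]|] //=; rewrite ?sqrtr_ge0 ?abs_ge0. Qed.

Lemma semiD i v w : semi i (v + w) <= semi i v + semi i w.
Proof.
case: i => [[a|b]|] /=; last by rewrite addr0.
  exact: absD.
exact: hilbD (energy_hilb b) _ _.
Qed.

Lemma semiZ i c w : semi i (c *: w) = abs c * semi i w.
Proof.
case: i => [[a|b]|] /=; last by rewrite mulr0.
  exact: absM.
rewrite (hilbZ (energy_hilb b)) sqrtrM ?sqr_ge0 // sqrtr_sqr.
by rewrite ger0_norm ?abs_ge0.
Qed.

Lemma semiN i w : semi i (- w) = semi i w.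
Proof. by rewrite -scaleN1r semiZ absN -(rmorph1 emb) abs_emb // mul1r. Qed.

Lemma semi_subC i v w : semi i (v - w) = semi i (w - v).
Proof. by rewrite -semiN opprB. Qed.

Lemma mass_ge0 n y : 0 <= mass n y.
Proof. exact: hilb_ge0 (mass_hilb n) y. Qed.

Lemma abs_le_semi b y x : (3 / 4) ^+ tag b.1 * abs (y b.1) <= semi (Some (inr b)) (x, y).
Proof.
rewrite /= -[leLHS]ger0_norm -?sqrtr_sqr ?ler_sqrt.
- by rewrite exprMn -exprM mulnC lerDl mass_ge0.
- exact: hilb_ge0 (energy_hilb b) y.
- by rewrite mulr_ge0 ?abs_ge0 // exprn_ge0 //; lra.
Qed.

Lemma semi_eq0 w : (forall i, semi i w = 0) -> w = 0.
Proof.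
case: w => x y w0; congr pair; apply/funext => a.
  exact: abs0_eq0 (w0 (Some (inl a))).
apply: (@abs0_eq0 _ _ s); apply/eqP; rewrite eq_le abs_ge0 andbT.
by have := abs_le_semi (a, 0%N) y x; rewrite w0 /= pmulr_rle0.
Qed.

Lemma member_submod : submod_closed (fun w => `[< member w >]).
Proof.
split=> [|c v w /asboolP[[M vM] v0 v1 v2] /asboolP[[N wN] w0 w1 w2]]; apply/asboolP.
  split.
  - by exists 0 => i; rewrite -(scale0r 0) semiZ abs0 mul0r.
  - by move=> e e0; exists 0%N => a _; rewrite abs0 ltW.
  - by move=> k i; rewrite !big1 ?mulr0 // => g _; rewrite mulr0.
  - by move=> k i; rewrite !big1 ?mulr0 // => g _; rewrite mulr0.
have bal x y : balanced x -> balanced y -> balanced (c *: x + y).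
  move=> bx bp k i.
  have E (l : nat) (f : point B l -> int) :
      \sum_g (f g)%:~R * (c *: x + y) (at_ g) =
      c * (\sum_g (f g)%:~R * x (at_ g)) + \sum_g (f g)%:~R * y (at_ g).
    rewrite big_distrr -big_split /=; apply: eq_bigr => g _.
    by rewrite mulrDr; congr (_ + _); rewrite mulrCA.
  by rewrite !E !mulrDr !(mulrCA _ c) bx bp.
split; [|move=> e e0|exact: bal|exact: bal].
  exists (abs c * M + N) => i; apply: le_trans (semiD _ _ _) _.
  by rewrite semiZ; apply: lerD => //; rewrite ler_wpM2l ?abs_ge0.
have c1 : 0 < abs c + 1 by have := abs_ge0 s c; lra.
have [m vm] := v0 (e / 2 / (abs c + 1)) ltac:(by rewrite !divr_gt0).
have [n wn] := w0 (e / 2) ltac:(lra).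
exists (maxn m n) => a; rewrite geq_max => /andP[/vm va /wn wa].
apply: le_trans (absD _ _ _) _; rewrite absM.
have : abs c * abs (v.1 a) <= e / 2.
  apply: le_trans (_ : (abs c + 1) * abs (v.1 a) <= _).
    by rewrite ler_wpM2r ?abs_ge0 //; lra.
  by rewrite -ler_pdivlMl // mulrC.
by move: wa; lra.
Qed.

Definition memberb w : bool := `[< member w >].

HB.instance Definition _ := GRing.isSubmodClosed.Build K
  ((site -> K) * (site -> K))%type memberb (GRing.submod_closed_semi member_submod).

Record space := Space { coords : (site -> K) * (site -> K); _ : memberb coords }.

HB.instance Definition _ := [isSub for coords].
HB.instance Definition _ := [Choice of space by <:].
HB.instance Definition _ := [SubChoice_isSubLmodule of space by <:].

Implicit Types u : space.

Lemma spaceP u : member (coords u).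
Proof. exact/asboolP/(valP u). Qed.

Lemma coordsD u v : coords (u + v) = coords u + coords v.
Proof. by []. Qed.

Lemma coordsB u v : coords (u - v) = coords u - coords v.
Proof. by []. Qed.

Definition rnorm u : R := sup [set semi i (coords u) | i in [set: _]].

Lemma semi_le_rnorm i u : semi i (coords u) <= rnorm u.
Proof.
apply: ub_le_sup; last by exists i.
by have [[M uM] _ _ _] := spaceP u; exists M => _ [j _ <-].
Qed.

Lemma rnorm_le u M : (forall i, semi i (coords u) <= M) -> rnorm u <= M.
Proof.
move=> uM; apply: ge_sup; first by exists (semi None (coords u)); exists None.
by move=> _ [i _ <-].
Qed.

Lemma rnorm_ge0 u : 0 <= rnorm u.
Proof. exact: semi_le_rnorm None u. Qed.

Let knorm u : K := emb (rnorm u).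

Lemma knormD u v : knorm (u + v) <= knorm u + knorm v.
Proof.
rewrite /knorm -rmorphD emb_le; apply: rnorm_le => i.
rewrite coordsD; apply: le_trans (semiD _ _ _) _.
by apply: lerD; exact: semi_le_rnorm.
Qed.

Lemma knormZ (c : K) u : knorm (c *: u) = `|c| * knorm u.
Proof.
rewrite /knorm (absE s) -rmorphM; congr (emb _).
have Z (d : K) (v : space) : rnorm (d *: v) <= abs d * rnorm v.
  apply: rnorm_le => i; rewrite (_ : coords _ = d *: coords v) //.
  by rewrite semiZ ler_wpM2l ?abs_ge0 ?semi_le_rnorm.
have [->|c0] := eqVneq c 0.
  rewrite abs0 mul0r; apply/eqP; rewrite eq_le rnorm_ge0 andbT.
  by apply: le_trans (Z _ _) _; rewrite abs0 mul0r.
apply/eqP; rewrite eq_le Z /= -[u in leLHS](scalerK c0).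
apply: le_trans (ler_wpM2l (abs_ge0 _ _) (Z _ _)) _.
by rewrite mulrA -absM divff // -(rmorph1 emb) abs_emb // mul1r.
Qed.

Lemma knorm_eq0 u : knorm u = 0 -> u = 0.
Proof.
move=> u0; apply: val_inj; apply: semi_eq0 => i.
apply/eqP; rewrite eq_le semi_ge0 andbT; apply: le_trans (semi_le_rnorm _ _) _.
by rewrite -(emb_le s) rmorph0 -u0.
Qed.

HB.instance Definition _ := @Lmodule_isNormed.Build K space knorm knormD knormZ knorm_eq0.

Lemma normE u : `|u| = emb (rnorm u).
Proof. by []. Qed.

End Space.

(** * Completeness and compactness *)

Section Limits.
Context (R : realType) (K : numFieldType) (s : scalars R K) (B : tower).
Local Notation emb := (emb s).
Local Notation abs := (abs s).
Local Notation site := {k : nat & point B k}.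
Local Notation at_ g := (Tagged (point B) g).
Implicit Types (x y z : site -> K).

Definition pointwise_limit (T : Type) (F : set_system T) (f : T -> site -> K) x :=
  forall a e, 0 < e -> F [set t | abs (f t a - x a) <= e].

Lemma pointwise_limit_ex (T : Type) (F : set_system T) (f : T -> site -> K) :
  UltraFilter F -> (forall a, exists M, F [set t | abs (f t a) <= M]) ->
  exists x, pointwise_limit F f x.
Proof.
move=> UF fM; have /choice [x xP] a : exists l, forall e, 0 < e ->
    F [set t | abs (f t a - l) <= e].
  by have [M FM] := fM a; exact: ultra_limit FM.
by exists x => a e; exact: xP.
Qed.

Lemma filter_all (T : Type) (F : set_system T) (I : eqType) (r : seq I) (P : I -> T -> Prop) :
  Filter F -> (forall i, F (P i)) -> F [set t | forall i, i \in r -> P i t].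
Proof.
move=> FF FP; elim: r => [|i r IH]; first by apply: filterE.
apply: filterS (filterI (FP i) IH) => t [Pi Pr] j.
by rewrite inE => /orP[/eqP->|/Pr].
Qed.

Section Filter.
Context (T : Type) (F : set_system T) (FF : ProperFilter F) (f : T -> site -> K) (x : site -> K).
Hypothesis fx : pointwise_limit F f x.

Lemma pointwise_limit_level n e : 0 < e ->
  F [set t | forall l (g : point B l), (l < n)%N -> abs (f t (at_ g) - x (at_ g)) <= e].
Proof.
move=> e0; pose P l t := forall g, g \in enum (point B l) -> abs (f t (at_ g) - x (at_ g)) <= e.
have FP l : F (P l) by apply: filter_all => g; exact: fx.
apply: filterS (filter_all (iota 0 n) _ FP) => t tP l g ln.
by apply: tP; rewrite ?mem_iota ?mem_enum.
Qed.

(** Each balance equation involves finitely many points, so it passes to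
    pointwise limits. *)
Lemma balanced_limit : F [set t | balanced (f t)] -> balanced x.
Proof.
move=> fb k i.
pose L l (c : point B l -> int) y := #|point B l|%:R^-1 * \sum_g (c g)%:~R * y (at_ g).
have LB l c y z : L l c (y - z) = L l c y - L l c z.
  rewrite /L -mulrBr -sumrB; congr (_ * _); apply: eq_bigr => g _.
  by rewrite -mulrBr.
apply/eqP; rewrite -subr_eq0; apply/eqP; apply: (@abs0_eq0 _ _ s).
apply/eqP; rewrite eq_le abs_ge0 andbT; apply/ler_addgt0Pr => e e0; rewrite add0r.
have e2 : 0 < e / 2 by lra.
have [t [/= tb tx]] := filter_ex (filterI fb (pointwise_limit_level k.+2 e2)).
rewrite -/(L k.+1 (fun g => sigma g i) x) -/(L k (fun g => tau g i) x).
have -> : L k.+1 (fun g => sigma g i) x - L k (fun g => tau g i) x =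
    L k (fun g => tau g i) (f t - x) - L k.+1 (fun g => sigma g i) (f t - x).
  have E : L k.+1 (fun g => sigma g i) (f t) = L k (fun g => tau g i) (f t) := tb k i.
  by rewrite !LB E; ring.
apply: le_trans (absB _ _ _) _; rewrite [leRHS](splitr e).
apply: lerD; apply: abs_sum_sign => //; try exact: ltW; try by move=> g; exact: tx.
- by move=> g; exact: tau_sign.
- by move=> g; exact: sigma_sign.
Qed.

End Filter.

Lemma sum_half_le (n : nat) : \sum_(l < n) (2^-1 : R) ^+ l <= 2.
Proof.
suff -> : \sum_(l < n) (2^-1 : R) ^+ l = 2 - 2 * 2^-1 ^+ n.
  by rewrite gerBl mulr_ge0 // exprn_ge0.
elim: n => [|n IH]; first by rewrite big_ord0 expr0; ring.
by rewrite big_ord_recr /= IH exprS; field.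
Qed.

Lemma sum_half_tail_le (m n : nat) (c d : R) : 0 <= c -> 0 <= d ->
  \sum_(l < n) 2^-1 ^+ l * (if (l < m)%N then c else d) <= 2 * c + 2 * 2^-1 ^+ m * d.
Proof.
move=> c0 d0; have p0 j : 0 <= (2^-1 : R) ^+ j by apply: exprn_ge0.
suff H : \sum_(l < n) 2^-1 ^+ l * (if (l < m)%N then c else d) <=
    2 * (1 - 2^-1 ^+ n) * c + (if (n < m)%N then 0 else 2 * (2^-1 ^+ m - 2^-1 ^+ n) * d).
  apply: le_trans H _; have := p0 n; have := p0 m; case: ifP => _ pm pn; nra.
elim: n => [|n IH].
  rewrite big_ord0 expr0 subrr mulr0 mul0r add0r; case: ifP => //.
  by case: m {p0} => //; rewrite expr0 subrr mulr0 mul0r.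
rewrite big_ord_recr /=; apply: le_trans (lerD IH (lexx _)) _.
have pn := p0 n; have pm := p0 m.
have [nm|mn|nm] := ltngtP n.+1 m.
- by rewrite !addr0 exprS; nra.
- by rewrite exprS; nra.
- by rewrite -nm subrr mulr0 mul0r !addr0 exprS; nra.
Qed.

Lemma mass_le n y (C : nat -> R) : (forall l, 0 <= C l) ->
  (forall l (g : point B l), (l < n)%N -> abs (y (at_ g)) ^+ 2 <= C l) ->
  mass s n y <= \sum_(l < n) 2^-1 ^+ l * C l.
Proof.
move=> C0 yC; apply: ler_sum => l _; apply: ler_wpM2l; first exact: exprn_ge0.
have [->|N0] := posnP #|point B l|; first by rewrite invr0 mul0r.
rewrite ler_pdivrMl ?ltr0n // mulr_natl -sumr_const.
by apply: ler_sum => g _; exact: yC.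
Qed.

(** Vectors bounded by [d] that are small on the first [m] levels have small
    energy for large [m]: the tail costs no more than the sum of the weights of
    the levels from [m] on. *)
Lemma energy_le b y m (c d : R) : 0 <= c -> 0 <= d ->
  (forall a : site, abs (y a) <= d) ->
  (forall l (g : point B l), (l < m)%N -> abs (y (at_ g)) <= c) ->
  energy s b y <= 3 * c ^+ 2 + ((3 / 4) ^+ (2 * m) + 2 * 2^-1 ^+ m) * d ^+ 2.
Proof.
move=> c0 d0 yd yc; rewrite /energy.
have q0 j : 0 <= (3 / 4 : R) ^+ j by apply: exprn_ge0; lra.
have sq (v e : R) : 0 <= v -> v <= e -> v ^+ 2 <= e ^+ 2.
  by move=> v0 ve; rewrite lerXn2r ?nnegrE // (le_trans v0).
have H1 : mass s b.2 y <= 2 * c ^+ 2 + 2 * 2^-1 ^+ m * d ^+ 2.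
  apply: le_trans (sum_half_tail_le m b.2 (sqr_ge0 c) (sqr_ge0 d)).
  apply: (mass_le (C := fun l => if (l < m)%N then c ^+ 2 else d ^+ 2)).
    by move=> l; case: ifP; rewrite sqr_ge0.
  move=> l g _; case: ifP => lm; apply: sq; rewrite ?abs_ge0 ?yd //; exact: yc.
have H2 : (3 / 4) ^+ (2 * tag b.1) * abs (y b.1) ^+ 2 <=
    c ^+ 2 + (3 / 4) ^+ (2 * m) * d ^+ 2.
  case: b.1 => l g /=; have [lm|ml] := ltnP l m.
    apply: ler_wpDr; first by rewrite mulr_ge0 ?sqr_ge0.
    apply: le_trans (_ : 1 * abs (y (at_ g)) ^+ 2 <= _).
      by rewrite ler_wpM2r ?sqr_ge0 // exprn_ile1 //; lra.
    by rewrite mul1r; apply: sq; rewrite ?abs_ge0 ?yc.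
  apply: ler_wpDl; first exact: sqr_ge0.
  apply: ler_pM; rewrite ?sqr_ge0 //.
    by rewrite ler_wiXn2l ?leq_mul2l //; lra.
  by apply: sq; rewrite ?abs_ge0 ?yd.
by move: H1 H2; rewrite mulrDl; lra.
Qed.

Lemma sqrt_le (a e : R) : 0 <= e -> a <= e ^+ 2 -> Num.sqrt a <= e.
Proof. by move=> e0 ae; rewrite -[leRHS]ger0_norm // -sqrtr_sqr ler_wsqrtr. Qed.

Section Space.
Local Notation space := (space s B).
Implicit Types (u v : space) (w : (site -> K) * (site -> K)).

Lemma ball_rnormE u v (e : R) : (ball u (emb e) v) = (rnorm (u - v) < e) :> Prop.
Proof. by rewrite -ball_normE /ball_ /= normE emb_lt. Qed.

Lemma gt0_emb (e : K) : 0 < e -> exists2 r : R, 0 < r & e = emb r.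
Proof.
move=> e0; exists (abs e); last by rewrite emb_abs // ltW.
by rewrite -(emb_lt s) rmorph0 emb_abs // ltW.
Qed.

Lemma abs_fst_le u a : abs ((coords u).1 a) <= rnorm u.
Proof. exact: semi_le_rnorm (Some (inl a)) u. Qed.

Lemma abs_snd_le u a : (3 / 4) ^+ tag a * abs ((coords u).2 a) <= rnorm u.
Proof.
apply: le_trans (semi_le_rnorm (Some (inr (a, 0%N))) u).
by have := abs_le_semi s (a, 0%N) (coords u).2 (coords u).1.
Qed.

Lemma abs_snd_le_rnorm u a : abs ((coords u).2 a) <= (4 / 3) ^+ tag a * rnorm u.
Proof.
have -> : abs ((coords u).2 a) =
    (4 / 3) ^+ tag a * ((3 / 4) ^+ tag a * abs ((coords u).2 a)).
  rewrite mulrA -exprMn (_ : 4 / 3 * (3 / 4) = 1); last by field.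
  by rewrite expr1n mul1r.
by rewrite ler_wpM2l ?abs_snd_le // exprn_ge0 //; lra.
Qed.

Lemma semi_limit (T : Type) (F : set_system T) (f : T -> (site -> K) * (site -> K)) w :
  ProperFilter F ->
  pointwise_limit F (fun t => (f t).1) w.1 ->
  pointwise_limit F (fun t => (f t).2) w.2 ->
  forall i e, 0 < e -> F [set t | semi s i (f t - w) <= e].
Proof.
move=> FF f1 f2 [[a|[a n]]|] e e0; last by apply: filterE => t /=; exact: ltW.
  exact: f1.
have e2 : 0 < e / 2 by lra.
have N0 := pointwise_limit_level FF f2 (maxn n (tag a).+1) e2.
apply: filterS N0 => t /= tn; apply: sqrt_le; first exact: ltW.
rewrite /energy /=.
have sq (c : K) : abs c <= e / 2 -> abs c ^+ 2 <= (e / 2) ^+ 2.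
  by move=> ce; rewrite lerXn2r ?nnegrE ?abs_ge0 // ltW.
have H1 : mass s n ((f t).2 - w.2) <= 2 * (e / 2) ^+ 2.
  apply: (@le_trans _ _ (\sum_(l < n) 2^-1 ^+ l * (e / 2) ^+ 2)).
    apply: (mass_le (C := fun=> (e / 2) ^+ 2)); first by move=> _; rewrite sqr_ge0.
    by move=> l g ln; apply: sq; apply: tn; rewrite leq_max ln.
  by rewrite -mulr_suml ler_wpM2r ?sqr_ge0 ?sum_half_le.
have H2 : (3 / 4) ^+ (2 * tag a) * abs ((f t).2 a - w.2 a) ^+ 2 <= (e / 2) ^+ 2.
  rewrite -[leRHS]mul1r; apply: ler_pM; rewrite ?sqr_ge0 //.
  - by rewrite exprn_ile1 //; lra.
  - by apply: sq; case: a tn => l g tn; apply: tn; rewrite leq_max ltnSn orbT.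
apply: le_trans (lerD H2 H1) _.
by rewrite expr_div_n; have := sqr_ge0 e; lra.
Qed.

(** An ultrafilter finer than a Cauchy filter has a pointwise limit, as the
    coordinates are bounded.  Since the seminorms are continuous for pointwise
    convergence and the filter is Cauchy uniformly in the seminorms, the filter
    converges to this limit in norm. *)
Lemma space_cauchy_cvg (F : set_system space) : ProperFilter F -> cauchy F -> cvg F.
Proof.
move=> FF /cauchy_ballP cF.
have small e : 0 < e -> exists2 A, F A & forall u v, A u -> A v -> rnorm (u - v) <= e.
  move=> e0; have [|[A A'] [FA FA'] H] := cF (emb e).
    by rewrite -(rmorph0 emb) emb_lt.
  exists (A `&` A') => [|u v [Au _] [_ A'v]]; first exact: filterI.
  by have := H (u, v) (conj Au A'v); rewrite /= ball_rnormE; exact: ltW.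
have [G [UG FG]] := ultraFilterLemma FF; have PG := @ultra_proper _ _ UG.
have [A FA A1] := small 1 ltr01; have [u0 Au0] := filter_ex FA.
have nA u : A u -> rnorm u <= rnorm u0 + 1.
  move=> Au; rewrite -(emb_le s) rmorphD -!normE -lerBlDl.
  apply: le_trans (lerB_dist _ _) _.
  by rewrite normE emb_le; exact: A1.
have [x xP] : exists x, pointwise_limit G (fun u : space => (coords u).1) x.
  apply: pointwise_limit_ex => a; exists (rnorm u0 + 1).
  by apply: filterS (FG _ FA) => u Au; apply: le_trans (abs_fst_le _ _) (nA _ Au).
have [y yP] : exists y, pointwise_limit G (fun u : space => (coords u).2) y.
  apply: pointwise_limit_ex => a; exists ((4 / 3) ^+ tag a * (rnorm u0 + 1)).
  apply: filterS (FG _ FA) => u Au; apply: le_trans (abs_snd_le_rnorm _ _) _.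
  by rewrite ler_wpM2l ?nA // exprn_ge0 //; lra.
have near_w e : 0 < e -> exists2 A, F A & forall u i, A u -> semi s i (coords u - (x, y)) <= e.
  move=> e0; have e2 : 0 < e / 2 by lra.
  have [C FC Ce] := small _ e2; exists C => // u i Cu.
  have [v [Cv /= vi]] := filter_ex (filterI (FG _ FC)
    (@semi_limit _ G (@coords _ _ s B) (x, y) PG xP yP i _ e2)).
  rewrite -(subrK (coords v) (coords u)) -addrA [leRHS](splitr e).
  apply: le_trans (semiD _ _ _ _) _; apply: lerD => //.
  by rewrite -coordsB; apply: le_trans (semi_le_rnorm _ _) (Ce _ _ Cu Cv).
have wP : member s (x, y).
  split => [|e e0||].
  - have [C FC C1] := near_w 1 ltr01; have [u Cu] := filter_ex FC.
    exists (rnorm u + 1) => i; rewrite -(subrK (coords u) (x, y)) addrC.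
    apply: le_trans (semiD _ _ _ _) _; apply: lerD; first exact: semi_le_rnorm.
    by rewrite semi_subC; exact: C1.
  - have e2 : 0 < e / 2 by lra.
    have [C FC Ce] := near_w _ e2; have [u Cu] := filter_ex FC.
    have [_ uv _ _] := spaceP u; have [n un] := uv _ e2.
    exists n => a /un ua /=; rewrite -(subrK ((coords u).1 a) (x a)) [leRHS](splitr e).
    apply: le_trans (absD _ _ _) _; apply: lerD => //.
    by rewrite abs_subC; exact: Ce u (Some (inl a)) Cu.
  - by apply: (balanced_limit PG xP); apply: filterE => u; have [] := spaceP u.
  - by apply: (balanced_limit PG yP); apply: filterE => u; have [] := spaceP u.
apply/cvg_ex; exists (Space (asboolT wP : memberb s _)).
apply/cvgrPdist_le => _ /gt0_emb[e e0 ->].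
have [C FC Ce] := near_w _ e0; apply: filterS FC => u Cu.
rewrite normE emb_le; apply: rnorm_le => i.
by rewrite coordsB semi_subC; exact: Ce.
Qed.

HB.instance Definition _ := Uniform_isComplete.Build space space_cauchy_cvg.

Lemma member_snd y : (exists M, forall a, abs (y a) <= M) -> balanced y ->
  member s (0, y).
Proof.
move=> [M yM] yb.
split => //=; first last.
- by move=> k i; rewrite !big1 ?mulr0 // => g _; rewrite mulr0.
- by move=> e e0; exists 0%N => a _; rewrite abs0 ltW.
exists (3 * `|M|) => -[[a|b]|] /=; rewrite ?abs0 ?mulr_ge0 //.
apply: sqrt_le; first by rewrite mulr_ge0.
apply: le_trans (energy_le (m := 0) (c := 0) (d := `|M|) b _ _ _ _) _ => //.
  by move=> a; apply: le_trans (yM a) (ler_norm _).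
by rewrite expr0; have := sqr_ge0 `|M|; nra.
Qed.

Definition unit_box : set space :=
  [set u | (coords u).1 = 0 /\ forall a, abs ((coords u).2 a) <= 1].

(** On bounded sets, pointwise convergence implies convergence for the norm of
    the second component, by [energy_le]: this is where the decreasing weights
    are used.  So ultrafilters on the box converge in norm. *)
Lemma unit_box_compact : compact unit_box.
Proof.
rewrite compact_ultra => F UF FK; have PF := @ultra_proper _ _ UF.
have [y yP] : exists y, pointwise_limit F (fun u : space => (coords u).2) y.
  apply: pointwise_limit_ex => a; exists 1.
  by apply: filterS FK => u [_]; exact.
have y1 a : abs (y a) <= 1.
  apply/ler_addgt0Pr => e e0.
  have [u [[_ u1] /= uy]] := filter_ex (filterI FK (yP a e e0)).
  rewrite -(subrK ((coords u).2 a) (y a)) addrC.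
  apply: le_trans (absD _ _ _) _; apply: lerD => //.
  by rewrite abs_subC.
have wP : member s (0, y).
  apply: member_snd; first by exists 1.
  by apply: (balanced_limit PF yP); apply: filterE => u; have [] := spaceP u.
exists (Space (asboolT wP : memberb s _)); split; first by split.
apply/cvgrPdist_le => _ /gt0_emb[e e0 ->].
(* By [energy_le] with d = 2, the levels from [m] on contribute at most half of
   e^2, and with c = e / 4 the others contribute at most 3 e^2 / 16. *)
have [m mP] : exists m, ((3 / 4) ^+ (2 * m) + 2 * 2^-1 ^+ m) * 2 ^+ 2 <= e ^+ 2 / 2 :> R.
  have q1 : `|3 / 4 : R| < 1 by rewrite ger0_norm; lra.
  have d0 : 0 < e ^+ 2 / 24 by rewrite divr_gt0 ?exprn_gt0.
  have /cvgr0Pnorm_le /(_ _ d0) [m _ /(_ m (leqnn m)) /=] := cvg_expr q1.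
  rewrite ger0_norm ?exprn_ge0 //.
  move=> qm; exists m; rewrite mulnC exprM expr2.
  have : (2^-1 : R) ^+ m <= (3 / 4) ^+ m by rewrite lerXn2r ?nnegrE //; lra.
  have q01 : (3 / 4 : R) ^+ m <= 1 by rewrite exprn_ile1 //; lra.
  have : 0 <= (3 / 4 : R) ^+ m by apply: exprn_ge0; lra.
  by move: qm q01; rewrite -[2 ^+ 2]/(2 * 2); nra.
have e4 : 0 < e / 4 by lra.
apply: filterS (filterI FK (pointwise_limit_level PF yP m e4)) => u [[u0 u1] um].
rewrite normE emb_le; apply: rnorm_le => i; rewrite semi_subC -coordsB.
case: i => [[a|b]|] /=; last exact: ltW.
  by rewrite u0 subr0 abs0 ltW.
apply: sqrt_le; first exact: ltW.
apply: le_trans (energy_le (m := m) (c := e / 4) (d := 2) b _ _ _ _) _ => //.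
- by rewrite ltW.
- move=> a; apply: le_trans (absB _ _ _) _.
  by have := u1 a; have := y1 a; lra.
- by have := sqr_ge0 e; nra.
Qed.

End Space.
End Limits.

(** * Traces of operators *)

Section Trace.
Context (R : realType) (K : numFieldType) (s : scalars R K) (B : tower).
Local Notation emb := (emb s).
Local Notation abs := (abs s).
Local Notation site := {k : nat & point B k}.
Local Notation at_ g := (Tagged (point B) g).
Local Notation label j := (Tagged (mode B) j).
Local Notation space := (space s B).
Implicit Types (x y z : site -> K) (u v : space).

Lemma mode_gt0 k : (0 < #|mode B k|)%N.
Proof. by rewrite card_mode expn_gt0. Qed.

Lemma point_gt0 k : (0 < #|point B k|)%N.
Proof. by rewrite card_point muln_gt0 expn_gt0. Qed.

(** The combination with coefficients [c] of all the vectors of all generations;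
    on a given level only two generations are present, so the sum makes sense
    without any condition on [c]. *)
Definition synthesis (c : {k : nat & mode B k} -> K) : site -> K := fun a =>
  \sum_i c (label i) * (sigma (tagged a) i)%:~R + \sum_i c (label i) * (tau (tagged a) i)%:~R.

Lemma average_mul (S T : finType) (m : nat) (f : S -> int) (h : S -> T -> int) (d : T -> int)
    (c : T -> K) : (0 < m)%N ->
  (forall j, \sum_g f g * h g j = m%:Z * d j) ->
  m%:R^-1 * \sum_g (f g)%:~R * \sum_j c j * (h g j)%:~R = \sum_j c j * (d j)%:~R.
Proof.
move=> m0 fh; under eq_bigr do rewrite big_distrr /=.
rewrite exchange_big big_distrr /=; apply: eq_bigr => j _.
have -> : \sum_g (f g)%:~R * (c j * (h g j)%:~R) = c j * (\sum_g f g * h g j)%:~R.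
  rewrite rmorph_sum big_distrr /=; apply: eq_bigr => g _.
  by rewrite rmorphM mulrCA.
rewrite fh rmorphM /= mulrCA; congr (_ * _).
by rewrite mulKf // pnatr_eq0 -lt0n.
Qed.

Lemma sum_pick (T : finType) (c : T -> K) i : \sum_j c j * (i == j)%:Z%:~R = c i.
Proof.
rewrite (bigD1 i) //= eqxx mulr1 big1 ?addr0 // => j ji.
by rewrite eq_sym (negbTE ji) mulr0.
Qed.

(** The columns of [sigma k] and [tau k] together are orthogonal, so pairing with
    one of them isolates its coefficient. *)
Lemma analysis_sigma c k (i : mode B k) :
  #|point B k|%:R^-1 * \sum_g (sigma g i)%:~R * synthesis c (at_ g) = c (label i).
Proof.
under eq_bigr do rewrite mulrDr; rewrite big_split mulrDr /=.
rewrite (average_mul (d := fun j => (i == j)%:Z)) ?point_gt0 //; last first.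
  by move=> j; rewrite sigma_orth -mulr_natr natz.
rewrite (average_mul (d := fun=> 0)) ?point_gt0 //; last first.
  by move=> j; rewrite sigma_tau_orth mulr0.
by rewrite (sum_pick (fun j => c (label j))) big1 ?addr0 // => j _; rewrite mulr0.
Qed.

Lemma analysis_tau c k (i : mode B k.+1) :
  #|point B k|%:R^-1 * \sum_g (tau g i)%:~R * synthesis c (at_ g) = c (label i).
Proof.
under eq_bigr do rewrite mulrDr; rewrite big_split mulrDr /=.
rewrite (average_mul (d := fun=> 0)) ?point_gt0 //; last first.
  by move=> j; under eq_bigr do rewrite mulrC; rewrite sigma_tau_orth mulr0.
rewrite (average_mul (d := fun j => (i == j)%:Z)) ?point_gt0 //; last first.
  by move=> j; rewrite tau_orth -mulr_natr natz.
by rewrite (sum_pick (fun j => c (label j))) big1 ?add0r // => j _; rewrite mulr0.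
Qed.

Lemma synthesis_balanced c : balanced (synthesis c).
Proof. by move=> k i; rewrite analysis_sigma analysis_tau. Qed.

Definition basis k (j : mode B k) := synthesis (fun t => (t == label j)%:R).

Lemma sum_label_eq k (j : mode B k) (f : mode B k -> K) :
  \sum_i (label i == label j)%:R * f i = f j.
Proof.
rewrite (bigD1 j) //= eqxx mul1r big1 ?addr0 // => i ij.
by rewrite eq_Tagged /= (negbTE ij) mul0r.
Qed.

Lemma sum_label_neq k l (j : mode B k) (f : mode B l -> K) : l != k ->
  \sum_i (label i == label j)%:R * f i = 0.
Proof.
move=> lk; apply: big1 => i _; case: eqP => [/(congr1 tag) /= E|_]; last exact: mul0r.
by rewrite E eqxx in lk.
Qed.

Lemma basis_sigma k (j : mode B k) g : basis j (at_ g) = (sigma g j)%:~R.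
Proof.
rewrite /basis /synthesis /= (sum_label_eq j (fun i => (sigma g i)%:~R)).
by rewrite sum_label_neq ?addr0 // eq_sym ltn_eqF.
Qed.

Lemma basis_tau k (j : mode B k.+1) (g : point B k) : basis j (at_ g) = (tau g j)%:~R.
Proof.
rewrite /basis /synthesis /= (sum_label_eq j (fun i => (tau g i)%:~R)).
by rewrite sum_label_neq ?add0r // ltn_eqF.
Qed.

Lemma basis_out k (j : mode B k) (a : site) : tag a != k -> (tag a).+1 != k ->
  basis j a = 0.
Proof. by move=> ak ak1; rewrite /basis /synthesis !sum_label_neq ?addr0. Qed.

Lemma abs_basis_le1 k (j : mode B k) a : abs (basis j a) <= 1.
Proof.
have [ak|ak] := eqVneq (tag a) k.
  by case: a ak => l g /= lk; subst l; rewrite basis_sigma abs_int sigma_sign.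
have [ak1|ak1] := eqVneq (tag a).+1 k.
  by case: a ak ak1 => l g /= _ lk; subst k; rewrite basis_tau abs_int tau_sign.
by rewrite basis_out // abs0.
Qed.

Lemma energy0 b : energy s b (0 : site -> K) = 0.
Proof.
by rewrite -(scale0r (0 : site -> K)) (hilbZ (energy_hilb s b)) abs0 expr0n mul0r.
Qed.

Lemma member_basis k (j : mode B k) : member s (basis j, 0).
Proof.
split=> /=.
- exists 1 => -[[a|b]|] //=; first exact: abs_basis_le1.
  by rewrite energy0 sqrtr0.
- move=> e e0; exists k.+1 => a ka; rewrite basis_out ?abs0 ?ltW //.
    by rewrite gtn_eqF.
  by rewrite gtn_eqF // (leq_trans ka).
- exact: synthesis_balanced.
- by move=> l i; rewrite !big1 ?mulr0 // => g _; rewrite mulr0.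
Qed.

Definition evec k (j : mode B k) : space := Space (asboolT (member_basis j) : memberb s _).

Lemma rnorm_evec_le1 k (j : mode B k) : rnorm (evec j) <= 1.
Proof.
apply: rnorm_le => -[[a|b]|] //=; first exact: abs_basis_le1.
by rewrite energy0 sqrtr0.
Qed.

Lemma member_demote u : member s (0, (coords u).1).
Proof.
have [_ _ u1 _] := spaceP u; apply: member_snd => //; exists (rnorm u).
exact: abs_fst_le.
Qed.

(** The compact operator of the counterexample: up to the zero components, the
    inclusion of the subspace of c_0 into the strictly convex space. *)
Definition demote u : space := Space (asboolT (member_demote u) : memberb s _).

Lemma demote_linear : linear demote.
Proof.
move=> c u v; apply: val_inj; rewrite /= -[RHS]/((_, _)); congr pair.
by apply/funext => a; rewrite /= -[RHS]/(c * 0 + 0) mulr0 addr0.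
Qed.

HB.instance Definition _ := GRing.isLinear.Build K space space *:%R demote demote_linear.

Definition coef k (i : mode B k) y : K :=
  #|point B k|%:R^-1 * \sum_g (sigma g i)%:~R * y (at_ g).

Definition trace k (V : space -> space) : K :=
  #|mode B k|%:R^-1 * \sum_(j : mode B k) coef j (coords (V (evec j))).2.

(** Chosen for [trace_step]: the first sum collects the vectors that
    [trace k.+1] tests with weight [tau g j] when it is read at the point g of
    level k, the second one those that [trace k] tests there. *)
Definition probe k (g : point B k) : space :=
  #|mode B k.+1|%:R^-1 *: (\sum_j (tau g j)%:~R *: evec j) -
  #|mode B k|%:R^-1 *: (\sum_j (sigma g j)%:~R *: evec j).

Lemma sndD u v a : (coords (u + v)).2 a = (coords u).2 a + (coords v).2 a.
Proof. by []. Qed.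

Lemma sndB u v a : (coords (u - v)).2 a = (coords u).2 a - (coords v).2 a.
Proof. by []. Qed.

Lemma sndZ (c : K) u a : (coords (c *: u)).2 a = c * (coords u).2 a.
Proof. by []. Qed.

Lemma fstD u v a : (coords (u + v)).1 a = (coords u).1 a + (coords v).1 a.
Proof. by []. Qed.

Lemma fstB u v a : (coords (u - v)).1 a = (coords u).1 a - (coords v).1 a.
Proof. by []. Qed.

Lemma fstZ (c : K) u a : (coords (c *: u)).1 a = c * (coords u).1 a.
Proof. by []. Qed.

Lemma snd_lincomb (V : {linear space -> space}) (T : finType) (c : T -> K)
    (f : T -> space) a :
  (coords (V (\sum_j c j *: f j))).2 a = \sum_j c j * (coords (V (f j))).2 a.
Proof.
rewrite (linear_sum V); elim/big_rec2: _ => [//|j y u _ <-].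
by rewrite sndD (linearZ_LR V) sndZ.
Qed.

Lemma fst_lincomb (T : finType) (c : T -> K) (f : T -> space) a :
  (coords (\sum_j c j *: f j)).1 a = \sum_j c j * (coords (f j)).1 a.
Proof.
elim/big_rec2: _ => [//|j y u _ <-].
by rewrite fstD fstZ.
Qed.

(** The values of V are balanced, so the coefficients in [trace k.+1 V] can be
    read on level k with [tau] instead of on level k + 1 with [sigma].  Exchanging
    the sum over the vectors with the sum over the points gives the probes. *)
Lemma trace_step k (V : {linear space -> space}) :
  trace k.+1 V - trace k V =
  #|point B k|%:R^-1 * \sum_(g : point B k) (coords (V (probe g))).2 (at_ g).
Proof.
have E (g : point B k) : (coords (V (probe g))).2 (at_ g) =
    #|mode B k.+1|%:R^-1 * (\sum_j (tau g j)%:~R * (coords (V (evec j))).2 (at_ g)) -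
    #|mode B k|%:R^-1 * (\sum_j (sigma g j)%:~R * (coords (V (evec j))).2 (at_ g)).
  by rewrite (linearB V) !(linearZ_LR V) sndB !sndZ !snd_lincomb.
rewrite (eq_bigr _ (fun g _ => E g)) sumrB mulrBr; congr (_ - _).
  rewrite -big_distrr /= mulrCA exchange_big /=; congr (_ * _); rewrite big_distrr /=.
  by apply: eq_bigr => j _; have [_ _ _ yb] := spaceP (V (evec j)); exact: yb.
rewrite -big_distrr /= mulrCA exchange_big /=; congr (_ * _); rewrite big_distrr /=.
by apply: eq_bigr.
Qed.

Lemma trace_demote k : trace k demote = 1.
Proof.
rewrite /trace (eq_bigr (fun=> 1)) => [|j _]; last by rewrite /coef analysis_sigma eqxx.
by rewrite sumr_const mulVf // pnatr_eq0 -lt0n mode_gt0.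
Qed.

Lemma abs_average_le (m : nat) (z : int) (b : nat) : `|z| <= b%:Z ->
  abs (m%:R^-1 * z%:~R) <= b%:R / m%:R.
Proof.
move=> zb; rewrite absM abs_natV abs_int mulrC ler_wpM2r ?invr_ge0 //.
by rewrite -[b%:R]/(b%:Z%:~R) ler_int.
Qed.

Lemma balance_ratio k : (balance k)%:R / (4 ^ k)%:R = (4 * k%:R + 8) * 2^-1 ^+ k :> R.
Proof.
rewrite /balance natrM natrD natrM !natrX exprVn.
rewrite (_ : 4%:R = 2 ^+ 2 :> R); last by rewrite -natrX.
by rewrite -exprM mulnC exprM expr2; field; rewrite expf_neq0.
Qed.

(** On each of the levels k + 1, k and k - 1 the values of [probe g] are
    normalized products of row g with other rows.  On level k the products of
    row g with itself occur with opposite signs and cancel at the point g; all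
    the other products are small. *)
Lemma rnorm_probe k (g : point B k) : rnorm (probe g) <= (8 * k%:R + 16) * 2^-1 ^+ k.
Proof.
set d := (X in _ <= X).
have p0 : 0 <= (2^-1 : R) ^+ k by apply: exprn_ge0.
have k0 : 0 <= k%:R :> R by [].
have d0 : 0 <= d by rewrite /d; nra.
apply: rnorm_le => -[[a|b]|] //; last first.
  have -> : semi s (Some (inr b)) (coords (probe g)) = semi s (Some (inr b)) (0, 0).
    congr (Num.sqrt (energy _ _ _)); apply/funext => a.
    have z0 (T : finType) (c : T -> K) (f : T -> space) : (forall j, (coords (f j)).2 = 0) ->
        (coords (\sum_j c j *: f j)).2 a = 0.
      by move=> f0; rewrite (snd_lincomb idfun) big1 // => j _; rewrite f0 mulr0.
    by rewrite /probe sndB !sndZ !z0 // !mulr0 subr0.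
  by rewrite /= energy0 sqrtr0.
have -> : semi s (Some (inl a)) (coords (probe g)) =
    abs (#|mode B k.+1|%:R^-1 * (\sum_j (tau g j)%:~R * basis j a) -
         #|mode B k|%:R^-1 * (\sum_j (sigma g j)%:~R * basis j a)).
  rewrite -[LHS]/(abs ((coords (probe g)).1 a)) /probe fstB !fstZ.
  by rewrite !fst_lincomb.
rewrite !card_mode; have bk := balance_ratio k; have bk1 := balance_ratio k.+1.
have prod1 (m : nat) (x : int) (T : finType) (f h : T -> int) (e : nat) :
    x = \sum_j f j * h j -> `|x| <= e%:Z ->
    abs (m%:R^-1 * \sum_j (f j)%:~R * (h j)%:~R) <= e%:R / m%:R.
  move=> -> xe; have := abs_average_le m xe; rewrite rmorph_sum /=.
  by under [in X in X -> _]eq_bigr do rewrite rmorphM.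
case: a => l h; have [lk|lk] := eqVneq l k.+1.
  subst l; rewrite (eq_bigr (fun j => (tau g j)%:~R * (sigma h j)%:~R)); last first.
    by move=> j _; rewrite basis_sigma.
  rewrite [X in _ - _ * X]big1 ?mulr0 ?subr0; last first.
    by move=> j _; rewrite basis_out ?mulr0 //= gtn_eqF // ltnW.
  apply: le_trans (prod1 _ _ _ _ _ _ erefl (tau_sigma_row g h)) _.
  by rewrite bk1 /d exprS -natr1; nra.
have [lk'|lk'] := eqVneq l k.
  subst l; rewrite (eq_bigr (fun j => (tau g j)%:~R * (tau h j)%:~R)); last first.
    by move=> j _; rewrite basis_tau.
  rewrite [X in _ - _ * X](eq_bigr (fun j => (sigma g j)%:~R * (sigma h j)%:~R)); last first.
    by move=> j _; rewrite basis_sigma.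
  have [->|gh] := eqVneq g h.
    rewrite (eq_bigr (fun=> 1)) => [|j _]; last by rewrite -rmorphM sign_sqr ?tau_sign.
    rewrite [X in _ - _ * X](eq_bigr (fun=> 1)) => [|j _]; last first.
      by rewrite -rmorphM sign_sqr ?sigma_sign.
    rewrite !sumr_const !card_mode !mulVf ?subrr ?abs0 //.
  apply: le_trans (absB _ _ _) _.
  have H1 := prod1 (4 ^ k.+1)%N _ _ _ _ _ erefl (tau_row gh).
  have H2 := prod1 (4 ^ k)%N _ _ _ _ _ erefl (sigma_row gh).
  apply: le_trans (lerD H1 H2) _.
  have -> : (4 * balance k)%:R / (4 ^ k.+1)%:R = (balance k)%:R / (4 ^ k)%:R :> R.
    by rewrite expnS !natrM; field; rewrite !pnatr_eq0 -lt0n expn_gt0.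
  by rewrite bk /d; nra.
rewrite big1 ?mulr0 ?sub0r ?absN; last first.
  by move=> j _; rewrite basis_out ?mulr0 //= eqSS.
have [lk1|lk1] := eqVneq l.+1 k.
  subst k; rewrite (eq_bigr (fun j => (sigma g j)%:~R * (tau h j)%:~R)); last first.
    by move=> j _; rewrite basis_tau.
  rewrite (eq_bigr (fun j => (tau h j)%:~R * (sigma g j)%:~R)); last first.
    by move=> j _; rewrite mulrC.
  apply: le_trans (prod1 _ _ _ _ _ _ erefl (tau_sigma_row h g)) _.
  by rewrite bk /d; nra.
by rewrite big1 ?mulr0 ?abs0 // => j _; rewrite basis_out ?mulr0.
Qed.

(** The increment at step k is at most e (8 k + 16) (2/3)^k, and this is the
    difference of consecutive terms of the sequence e (24 k + 96) (2/3)^k; at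
    k = 0 the trace is at most e. *)
Lemma trace_bound (V : {linear space -> space}) (e : R) k : 0 <= e ->
  (forall u, rnorm (V u) <= e * rnorm u) ->
  abs (trace k V) <= 97 * e.
Proof.
move=> e0 Ve; have p0 j : 0 <= (2 / 3 : R) ^+ j by apply: exprn_ge0; lra.
suff : abs (trace k V) <= e * (97 - (24 * k%:R + 96) * (2 / 3) ^+ k).
  move/le_trans; apply; rewrite [leRHS]mulrC ler_wpM2l // gerBl.
  by rewrite mulr_ge0.
elim: k => [|k IH].
  rewrite expr0 mulr0 add0r mulr1 (_ : 97 - 96 = 1); last by ring.
  rewrite mulr1 /trace.
  under eq_bigr do rewrite -[coef _ _]mul1r -[1]/(1%:~R).
  apply: (abs_sum_sign (c := fun=> 1)) => // j; apply: abs_sum_sign => //.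
    by move=> i; exact: sigma_sign.
  move=> i; have := abs_snd_le (V (evec j)) (at_ i).
  rewrite expr0 mul1r => /le_trans; apply; apply: le_trans (Ve _) _.
  by rewrite -[leRHS]mulr1 ler_wpM2l ?rnorm_evec_le1.
rewrite -(subrK (trace k V) (trace k.+1 V)); apply: le_trans (absD _ _ _) _.
have step : abs (trace k.+1 V - trace k V) <= (4 / 3) ^+ k * (e * ((8 * k%:R + 16) * 2^-1 ^+ k)).
  rewrite trace_step; under eq_bigr do rewrite -[(coords _).2 _]mul1r -[1]/(1%:~R).
  have b0 : 0 <= (4 / 3) ^+ k * (e * ((8 * k%:R + 16) * 2^-1 ^+ k)) :> R.
    by rewrite !mulr_ge0 ?exprn_ge0 ?addr_ge0 ?mulr_ge0 //; lra.
  apply: (abs_sum_sign (c := fun=> 1)) => // g.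
  apply: le_trans (abs_snd_le_rnorm _ _) _; apply: ler_wpM2l; first by apply: exprn_ge0; lra.
  by apply: le_trans (Ve _) _; rewrite ler_wpM2l // rnorm_probe.
apply: le_trans (lerD step IH) _.
have -> : (4 / 3) ^+ k * (e * ((8 * k%:R + 16) * 2^-1 ^+ k)) =
    e * (8 * k%:R + 16) * (2 / 3) ^+ k :> R.
  rewrite (_ : 2 / 3 = 4 / 3 * 2^-1 :> R); last by field.
  by rewrite (exprMn k (4 / 3)); move: ((4 / 3) ^+ k) (2^-1 ^+ k) => p q; ring.
rewrite exprS -natr1 -mulrA -mulrDr; apply: ler_wpM2l => //.
by have := p0 k; nra.
Qed.

End Trace.

(** * Norm-attaining operators *)

Section NormAttaining.
Context (R : realType) (K : numFieldType) (s : scalars R K) (B : tower).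
Local Notation emb := (emb s).
Local Notation abs := (abs s).
Local Notation site := {k : nat & point B k}.
Local Notation at_ g := (Tagged (point B) g).
Local Notation space := (space s B).
Implicit Types (x y z : site -> K) (u v p q : space).

Lemma mass_mono m n y : (m <= n)%N -> mass s m y <= mass s n y.
Proof.
move=> mn; rewrite -(subnKC mn) /mass big_split_ord /= lerDl.
apply: sumr_ge0 => l _; rewrite mulr_ge0 ?exprn_ge0 ?mulr_ge0 ?invr_ge0 //.
by apply: sumr_ge0 => g _; exact: sqr_ge0.
Qed.

Lemma energy_mono a m n y : (m <= n)%N -> energy s (a, m) y <= energy s (a, n) y.
Proof. by move=> mn; rewrite lerD2l mass_mono. Qed.

Lemma energy_ge_term a n l (g : point B l) y : (l < n)%N ->
  2^-1 ^+ l * (#|point B l|%:R^-1 * abs (y (at_ g)) ^+ 2) <= energy s (a, n) y.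
Proof.
move=> ln; apply: ler_wpDl; first by rewrite mulr_ge0 ?sqr_ge0 ?exprn_ge0 //; lra.
apply: le_trans (mass_mono y ln).
rewrite /mass big_ord_recr /= ler_wpDl ?mass_ge0 // ler_wpM2l ?exprn_ge0 //.
rewrite ler_wpM2l ?invr_ge0 // (bigD1 g) //= lerDl.
by apply: sumr_ge0 => h _; exact: sqr_ge0.
Qed.

Lemma energy_le_rnorm b u : energy s b (coords u).2 <= rnorm u ^+ 2.
Proof.
rewrite -[leLHS]sqr_sqrtr; last exact: hilb_ge0 (energy_hilb s b) _.
by rewrite lerXn2r ?nnegrE ?sqrtr_ge0 ?rnorm_ge0 //; exact: semi_le_rnorm (Some (inr b)) u.
Qed.

(** When the first component is strictly shorter than the vector, the norm is
    the supremum over the seminorms of the second component. *)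
Lemma energy_near_rnorm u (m e : R) : m < rnorm u ->
  (forall a, abs ((coords u).1 a) <= m) -> 0 <= m -> 0 < e ->
  exists b, rnorm u ^+ 2 - e <= energy s b (coords u).2.
Proof.
move=> mu um m0 e0; apply: contrapT => /forallNP far.
pose r := Num.max m (Num.sqrt (rnorm u ^+ 2 - e)).
have : rnorm u <= r.
  apply: rnorm_le => -[[a|b]|] /=; rewrite /r le_max ?um ?m0 //; apply/orP; right.
  by apply: ler_wsqrtr; rewrite leNgt; apply/negP => /ltW; exact: far.
apply/negP; rewrite -ltNge /r gt_max mu /=.
have u0 : 0 < rnorm u by exact: le_lt_trans mu.
rewrite -[ltRHS]ger0_norm ?ltW // -sqrtr_sqr ltr_sqrt ?exprn_gt0 //.
by rewrite ltrBlDr ltrDl.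
Qed.

(** By the parallelogram identity, a seminorm that nearly attains the norm of
    p is small at q.  Increasing [n] can only bring the seminorm of p closer to
    the norm, so [n] may be taken so large that the quadratic part sees any
    given point of q. *)
Lemma strict_convexity p q (m : R) : 0 <= m -> m < rnorm p ->
  (forall a, abs ((coords p).1 a) <= m) ->
  rnorm (p + q) <= rnorm p -> rnorm (p - q) <= rnorm p -> (coords q).2 = 0 :> (site -> K).
Proof.
move=> m0 mp pm pq1 pq2.
have small e : 0 < e -> exists b, forall n, (b.2 <= n)%N ->
      energy s (b.1, n) (coords q).2 <= e.
  move=> e0; have [[a n] bP] := energy_near_rnorm mp pm m0 e0.
  exists (a, n) => // n' /= nn'.
  have := hilb_parallelogram (energy_hilb s (a, n')) (coords p).2 (coords q).2.
  have H1 := le_trans (energy_le_rnorm (a, n') (p + q)) (_ : _ <= rnorm p ^+ 2).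
  have H2 := le_trans (energy_le_rnorm (a, n') (p - q)) (_ : _ <= rnorm p ^+ 2).
  have H3 := le_trans bP (energy_mono a (coords p).2 nn').
  have {}H1 := H1 ltac:(by rewrite lerXn2r ?nnegrE ?rnorm_ge0).
  have {}H2 := H2 ltac:(by rewrite lerXn2r ?nnegrE ?rnorm_ge0).
  rewrite -[((coords p).2 + _)]/((coords (p + q)).2) -[((coords p).2 - _)]/((coords (p - q)).2).
  by move: H1 H2 H3; lra.
apply/funext => -[l g]; apply: (@abs0_eq0 _ _ s).
apply/eqP; rewrite -sqrf_eq0 eq_le sqr_ge0 andbT; apply/ler_addgt0Pr => e e0.
rewrite add0r; pose c : R := 2^-1 ^+ l * #|point B l|%:R^-1.
have c0 : 0 < c by rewrite mulr_gt0 ?exprn_gt0 ?invr_gt0 ?ltr0n ?point_gt0.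
have [b bP] := small (c * e) (mulr_gt0 c0 e0).
rewrite -(ler_pM2l c0); apply: le_trans (bP (maxn b.2 l.+1) (leq_maxl _ _)).
apply: le_trans (energy_ge_term b.1 g _ (leq_maxr b.2 l.+1)).
by rewrite mulrA.
Qed.

Lemma rnormZ (c : K) u : rnorm (c *: u) = abs c * rnorm u.
Proof. by apply: (@emb_inj _ _ s); rewrite rmorphM -absE -!normE normrZ. Qed.

Lemma rnorm0 : rnorm (0 : space) = 0.
Proof. by rewrite -(scale0r (0 : space)) rnormZ abs0 mul0r. Qed.

Lemma norm_le_emb u (r : R) : (`|u| <= emb r) = (rnorm u <= r).
Proof. by rewrite normE emb_le. Qed.

Lemma linear_bound (V : {linear space -> space}) (r : R) :
  (forall u, rnorm u <= 1 -> rnorm (V u) <= r) -> forall u, rnorm (V u) <= r * rnorm u.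
Proof.
move=> Vr u; have [u0|u0] := eqVneq (rnorm u) 0.
  have -> : u = 0 by apply/eqP; rewrite -normr_eq0 normE u0 rmorph0.
  by rewrite linear0 rnorm0 mulr0.
have up : 0 < rnorm u by rewrite lt_def u0 rnorm_ge0.
have c0 : 0 <= (rnorm u)^-1 by rewrite invr_ge0 ltW.
have := Vr (emb (rnorm u)^-1 *: u); rewrite rnormZ abs_emb // mulVf // => /(_ (lexx _)).
by rewrite (linearZ_LR V) rnormZ abs_emb // mulrC ler_pdivrMr.
Qed.

Lemma bounded_operator_norm (V : {linear space -> space}) :
  bounded_operator V -> exists M : R, forall u, rnorm u <= 1 -> rnorm (V u) <= M.
Proof.
case=> M VM; exists (abs M) => u u1.
have := VM u; have M0 : 0 <= M * `|u| by apply: le_trans (VM u).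
rewrite -(emb_abs s M0) (normE (V u)) emb_le absM normE abs_emb ?rnorm_ge0 // => /le_trans; apply.
by rewrite -[leRHS]mulr1 ler_wpM2l ?abs_ge0.
Qed.

(** The norms of the values lie in the image of [R], where they have a supremum;
    an upper bound in [K] of a nonempty subset of this image lies in the image as
    well, so this supremum is also the supremum in [K]. *)
Lemma opnorm_ex (f : space -> space) (M : R) :
  (forall u, rnorm u <= 1 -> rnorm (f u) <= M) ->
  exists2 r, opnorm f = emb r & forall u, rnorm u <= 1 -> rnorm (f u) <= r.
Proof.
move=> fM; pose A := [set rnorm (f u) | u in [set u | rnorm u <= 1]].
have n0 : rnorm (0 : space) <= 1 by rewrite rnorm0.
have A0 : A !=set0 by exists (rnorm (f 0)); exists 0.
have Ab : has_ubound A by exists M => _ [u u1 <-]; exact: fM.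
exists (sup A); last by move=> u u1; apply: ub_le_sup => //; exists u.
rewrite /opnorm; set E := [set `|f z| | z in _].
have EA (t : R) : A t -> E (emb t).
  by case=> u u1 <-; exists u; rewrite ?normE //= -(rmorph1 emb) emb_le.
have AE (t : K) : E t -> exists2 r, A r & t = emb r.
  case=> u /= u1 <-; exists (rnorm (f u)) => //.
  by exists u => //=; rewrite -(emb_le s) rmorph1.
have supE : supremums E (emb (sup A)).
  split=> [_ /AE[r Ar ->]|t tE]; first by rewrite emb_le ub_le_sup.
  have [r0 Ar0] := A0; have h0 := tE _ (EA _ Ar0).
  have -> : t = emb (abs (t - emb r0) + r0).
    by rewrite rmorphD emb_abs ?subr_ge0 // subrK.
  rewrite emb_le; apply: ge_sup => // r Ar; rewrite -(emb_le s).
  by rewrite rmorphD emb_abs ?subr_ge0 // subrK; exact: tE (EA _ Ar).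
rewrite /supremum; case: ifPn => [/eqP E0|_].
  by have [r0 /EA] := A0; rewrite E0.
exact: (@is_subset1_supremums _ _ E _ _ (xgetPex 0 (ex_intro _ _ supE)) supE).
Qed.

Lemma demote_compact : compact_operator (demote (s := s) (B := B)).
Proof.
exists (unit_box (s := s) (B := B)); last first.
  split; first exact: unit_box_compact.
  apply: compact_closed; first exact: norm_hausdorff.
  exact: unit_box_compact.
move=> _ [u /= u1 <-]; split=> //= a.
apply: le_trans (abs_fst_le u a) _.
by rewrite -norm_le_emb rmorph1.
Qed.

Lemma evec_neq0 : exists u : space, u != 0.
Proof.
have [j _] := card_gt0P (mode_gt0 B 0); have [g _] := card_gt0P (point_gt0 B 0).
exists (evec s j); apply/eqP => /(congr1 (fun u => abs ((coords u).1 (at_ g)))).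
by rewrite /= basis_sigma abs_int sigma_sign abs0 => /eqP; rewrite oner_eq0.
Qed.

(** An operator [T] within 1/100 of (x, y) |-> (0, x) has a first component of
    norm at most 1/100 and norm at least 99/100, so that at the point where T
    attains its norm the second component carries it, and [strict_convexity]
    applies to all the vectors of a late generation.  The trace of the
    difference over this generation is 1, more than [trace_bound] allows. *)
Lemma demote_not_closure : ~ opnorm_closure (NA space) (demote (s := s) (B := B)).
Proof.
case=> /bounded_operator_norm[M1 SM] /(_ (emb (1 / 100))).
have e0 : (0 : K) < emb (1 / 100) by rewrite -(rmorph0 emb) emb_lt; lra.
case/(_ e0) => T [[/bounded_operator_norm[M2 TM] [z0 [z01 Tz0]]]].
pose S : {linear space -> space} := demote (s := s) (B := B).
pose V : {linear space -> space} := S \- T.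
have [|r1 -> r1P] := @opnorm_ex (S \- T) (M1 + M2).
  move=> u u1; rewrite -norm_le_emb rmorphD; apply: le_trans (ler_normB _ _) _.
  by apply: lerD; rewrite norm_le_emb; [exact: SM|exact: TM].
rewrite emb_lt => r1e.
have STe : forall u, rnorm u <= 1 -> rnorm (S u - T u) <= 1 / 100.
  by move=> u /r1P/le_trans; apply; exact: ltW.
have [m Tm mP] := opnorm_ex TM.
have {}Tz0 : rnorm (T z0) = m.
  by apply: (@emb_inj _ _ s); rewrite -normE Tz0 Tm.
have {}z01 : rnorm z0 = 1 by apply: (@emb_inj _ _ s); rewrite -normE z01 rmorph1.
have m1 : 1 / 100 < m.
  have [j _] := card_gt0P (mode_gt0 B 0); have [g _] := card_gt0P (point_gt0 B 0).
  have e1 := rnorm_evec_le1 s j.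
  have : 1 <= rnorm (S (evec s j)).
    have := abs_snd_le (S (evec s j)) (at_ g).
    by rewrite expr0 mul1r /= basis_sigma abs_int sigma_sign.
  have := STe _ e1; have := mP _ e1.
  have : rnorm (S (evec s j)) <= rnorm (S (evec s j) - T (evec s j)) + rnorm (T (evec s j)).
    by rewrite -(emb_le s) rmorphD -!normE -[S _ in leLHS](subrK (T (evec s j))) ler_normD.
  by lra.
have Tx a : abs ((coords (T z0)).1 a) <= 1 / 100.
  rewrite -absN -sub0r -[_ - _]/((coords (S z0 - T z0)).1 a).
  by apply: le_trans (abs_fst_le _ _) _; apply: STe; rewrite z01.
have [n nP] : exists n, forall a : site, (n <= tag a)%N -> abs ((coords z0).1 a) <= 1 / 2.
  by have [_ zv _ _] := spaceP z0; apply: zv; lra.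
(* Vectors of generation n + 1 live on the levels n and n + 1, where the first
   component of [z0] is at most 1/2. *)
have Te (j : mode B n.+1) : (coords (T (evec s j))).2 = 0.
  pose v : space := emb (1 / 2) *: evec s j.
  have zv (w : space) : w = v \/ w = - v -> rnorm (z0 + w) <= 1.
    move=> wv; apply: rnorm_le => -[[a|b]|] //=.
      have wa : abs ((coords w).1 a) = 1 / 2 * abs (basis _ j a).
        have va : abs ((coords v).1 a) = 1 / 2 * abs (basis _ j a).
          by rewrite /v fstZ absM abs_emb //; lra.
        by case: wv => ->; rewrite // -va -[RHS]absN.
      have [na|an] := leqP n (tag a).
        apply: le_trans (absD _ _ _) _; rewrite wa.
        by have := nP _ na; have := abs_basis_le1 s j a; lra.
      have b0 : basis K j a = 0.
        by rewrite basis_out // ltn_eqF // ltnS // ltnW.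
      apply: le_trans (absD _ _ _) _; rewrite wa b0 abs0 mulr0 addr0.
      by apply: le_trans (abs_fst_le _ _) _; rewrite z01.
    have w0 : (coords w).2 = 0.
      have v0 : (coords v).2 = 0 by apply/funext => a; rewrite /v sndZ mulr0.
      by case: wv => ->; rewrite // -[LHS]/(- (coords v).2) v0 oppr0.
    by rewrite w0 addr0 -z01; exact: semi_le_rnorm (Some (inr b)) z0.
  have Tv0 : (coords (T v)).2 = 0.
    apply: (@strict_convexity (T z0) _ (1 / 100)) => //; rewrite ?Tz0 //.
      by rewrite -linearD; apply: mP; apply: zv; left.
    by rewrite -linearB; apply: mP; apply: zv; right.
  have h0 : emb (1 / 2) != 0 by rewrite gt_eqF // -(rmorph0 emb) emb_lt; lra.
  apply/funext => a; have := congr1 (fun f => f a) Tv0.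
  by rewrite /v (linearZ_LR T) sndZ => /eqP; rewrite mulf_eq0 (negbTE h0) => /eqP.
have V1 : trace n.+1 V = 1.
  rewrite -[RHS](trace_demote s B n.+1); congr (_ * _); apply: eq_bigr => j _.
  congr (coef _ _); apply/funext => a.
  by rewrite -[LHS]/((coords (S (evec s j))).2 a - (coords (T (evec s j))).2 a) Te subr0.
have e1 : (0 : R) <= 1 / 100 by lra.
have Ve : forall u, rnorm (V u) <= 1 / 100 * rnorm u by exact: linear_bound.
have := trace_bound n.+1 e1 Ve.
by rewrite V1 -(rmorph1 emb) abs_emb //; lra.
Qed.

End NormAttaining.

Lemma compact_not_norm_attaining_limit (R : realType) (K : numFieldType) (s : scalars R K) :
  exists (Z : completeNormedModType K) (S : {linear Z -> Z}),
    [/\ exists z : Z, z != 0, compact_operator S & ~ opnorm_closure (NA Z) S].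
Proof.
have [B] := exists_tower; exists (space s B), (demote (s := s) (B := B)); split.
- exact: evec_neq0.
- exact: demote_compact.
- exact: demote_not_closure.
Qed.

Theorem theorem8 (R : realType) :
  (exists (Z : completeNormedModType R) (S : {linear Z -> Z}),
      [/\ exists z : Z, z != 0,
          compact_operator S
        & ~ opnorm_closure (NA Z) S]) /\
  (exists (Z : completeNormedModType R[i]) (S : {linear Z -> Z}),
      [/\ exists z : Z, z != 0,
          compact_operator S
        & ~ opnorm_closure (NA Z) S]).
Proof.
split; first exact: compact_not_norm_attaining_limit (real_scalars R).
exact: compact_not_norm_attaining_limit (complex_scalars R).
Qed.
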